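(* Let $A$ be a Hopf $\ast$-algebra, $H$ a compact quantum group algebra, and $B=A^{\mathrm{co}(H)}$ a quantum homogeneous space. Let $(\Omega^{(\bullet,\bullet)},\wedge,\partial,\overline{\partial})$ be an $A$-covariant complex structure on $B$ such that $\Omega^1$ is an object of the category ${}^{A}_{B}\mathrm{mod}_0$. Fix $H$-invariant inner products $\langle\ ,\ \rangle_{V^{(1,0)}}$ and $\langle\ ,\ \rangle_{V^{(0,1)}}$ on $V^{(1,0)}=\Phi(\Omega^{(1,0)})$ and $V^{(0,1)}=\Phi(\Omega^{(0,1)})$ respectively, and let $((\ ,\ )^{1,0},\mathrm{coev}^{1,0})$ and $((\ ,\ )^{0,1},\mathrm{coev}^{0,1})$ be the associated morphisms defined in the context. For $\lambda\in\mathbb{R}\setminus\{0\}$ define $(\ ,\ )_{\Omega^1}:\Omega^1\otimes_B\Omega^1\to B$ to be $(\ ,\ )^{1,0}$ on $\Omega^{(1,0)}\otimes_B\Omega^{(0,1)}$, $-\lambda^{-1}(\ ,\ )^{0,1}$ on $\Omega^{(0,1)}\otimes_B\Omega^{(1,0)}$, and $0$ on $\Omega^{(1,0)}\otimes_B\Omega^{(1,0)}$ and $\Omega^{(0,1)}\otimes_B\Omega^{(0,1)}$; define $\mathrm{coev}_{\Omega^1}=\mathrm{coev}^{1,0}+(-\lambda)\,\mathrm{coev}^{0,1}:B\to\Omega^1\otimes_B\Omega^1$, and put $g=\mathrm{coev}_{\Omega^1}(1)$. Then $(g,(\ ,\ )_{\Omega^1})$ is an $A$-covariant real metric on $\Omega^1$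 which satisfies $$(\omega,\eta)_{\Omega^1}=0\quad\text{if }\omega,\eta\in\Omega^{(1,0)}\text{ or if }\omega,\eta\in\Omega^{(0,1)}.$$
   Context: All algebras are unital over $\mathbb{C}$; antipodes are bijective; Sweedler notation is $\Delta(a)=a_{(1)}\otimes a_{(2)}$ and $m\mapsto m_{(-1)}\otimes m_{(0)}$ for left coactions. Quantum homogeneous space: $A,H$ are Hopf $\ast$-algebras, $\pi:A\to H$ is a surjective Hopf $\ast$-algebra map, $B=A^{\mathrm{co}(H)}=\{a\in A: a_{(1)}\otimes\pi(a_{(2)})=a\otimes 1\}$, and $A$ is faithfully flat as a right $B$-module. $B$ is a left $A$-comodule $\ast$-algebra via $\Delta$. $H$ is a compact quantum group algebra if it is the Hopf $\ast$-algebra spanned by the matrix coefficients of the irreducible unitary corepresentations of a compact quantum group. ${}^{A}_{B}\mathcal{M}_B$ is the category of $B$-bimodules $M$ with a left $A$-coaction satisfying $\delta(bmc)=b_{(1)}m_{(-1)}c_{(1)}\otimes b_{(2)}m_{(0)}c_{(2)}$; morphisms are $B$-bilinear, left $A$-colinear maps. Let $B^+=B\cap\ker\epsilon$. ${}^{A}_{B}\mathrm{mod}_0$ is the full subcategory of objects finitely generated as left $B$-modules with $MB^+=B^+M$; it is monoidal under $\otimes_B$. $\Phi(M)=M/(B^+M)$, with left $H$-coaction $[m]\mapsto\pi(m_{(-1)})\otimes[m_{(0)}]$, is a monoidal equivalence from ${}^{A}_{B}\mathrm{mod}_0$ to finite dimensional left $H$-comodules, with $\Phi(M)\otimes\Phi(N)\cong\Phi(M\otimes_BN)$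 via $[m]\otimes[n]\mapsto[m\otimes n]$ and $\Phi(B)\cong\mathbb{C}$ via $\epsilon$. A differential calculus over $B$ is a differential graded algebra $(\Omega^\bullet,\wedge,d)$ with $\Omega^0=B$, generated by $B$ and $dB$; a $\ast$-calculus has a degree-preserving conjugate-linear involution extending $\ast$ on $B$ with $(d\omega)^*=d(\omega^* )$, $(\omega\wedge\nu)^*=(-1)^{kl}\nu^*\wedge\omega^*$; it is $A$-covariant if the coaction of $B$ extends to a comodule $\ast$-algebra coaction on $\Omega^\bullet$ with every $\Omega^k\in{}^{A}_{B}\mathcal{M}_B$ and $d$ colinear. A complex structure on a $\ast$-calculus is an $\mathbb{N}_0^2$-algebra grading $\Omega^\bullet=\bigoplus\Omega^{(p,q)}$ with $\Omega^k=\bigoplus_{p+q=k}\Omega^{(p,q)}$, $(\Omega^{(p,q)})^*=\Omega^{(q,p)}$, $d\Omega^{(p,q)}\subseteq\Omega^{(p+1,q)}\oplus\Omega^{(p,q+1)}$; $\partial,\overline\partial$ are the components of $d$ of bidegree $(1,0)$ and $(0,1)$. It is $A$-covariant if the $\ast$-calculus is $A$-covariant and all $\Omega^{(p,q)}$ are subcomodules. An inner product (conjugate linear on the right) on a left $H$-comodule is $H$-invariant if $v_{(-1)}w_{(-1)}^*\langle v_{(0)},w_{(0)}\rangle=\langle v,w\rangle1_H$. $(\ ,\ )^{1,0}:\Omega^{(1,0)}\otimes_B\Omega^{(0,1)}\to B$ and $\mathrm{coev}^{1,0}:B\to\Omega^{(0,1)}\otimes_B\Omega^{(1,0)}$ are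 the morphisms in ${}^{A}_{B}\mathrm{mod}_0$ whose images under $\Phi$ are $[\omega]\otimes[\eta]\mapsto\langle[\omega],[\eta^*]\rangle_{V^{(1,0)}}$ and $1\mapsto\sum_i v_i^\star\otimes v_i$, where $\{v_i\}$ is an orthonormal basis of $V^{(1,0)}$ and $[\omega]^\star:=[\omega^*]$. Similarly $(\ ,\ )^{0,1}:\Omega^{(0,1)}\otimes_B\Omega^{(1,0)}\to B$ and $\mathrm{coev}^{0,1}:B\to\Omega^{(1,0)}\otimes_B\Omega^{(0,1)}$ are defined from $\langle\ ,\ \rangle_{V^{(0,1)}}$ on $V^{(0,1)}$. A metric on $\Omega^1$ is a pair $(g,(\ ,\ ))$ with $g\in\Omega^1\otimes_B\Omega^1$ and $(\ ,\ ):\Omega^1\otimes_B\Omega^1\to B$ $B$-bilinear such that $((\omega,\ )\otimes_B\mathrm{id})g=\omega=(\mathrm{id}\otimes_B(\ ,\omega))g$ for all $\omega$. It is $A$-covariant if $(\ ,\ )$ and $b\mapsto bg$ are left $A$-colinear, and real if $g^\dagger=g$, where $(\omega\otimes_B\eta)^\dagger=\eta^*\otimes_B\omega^*$ (antilinear). *)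

(* Defs.v *)
(* The complex numbers are R[i] for R : realType. *)
From HB Require Import structures.
From mathcomp Require Import all_boot all_order all_algebra.
From mathcomp Require Import boolp classical_sets reals.
From mathcomp Require Import complex.

Set Implicit Arguments.
Unset Strict Implicit.
Unset Printing Implicit Defensive.

Import Order.TTheory GRing.Theory Num.Theory.
Local Open Scope ring_scope.
Local Open Scope quotient_scope.

Section Subspaces.
Context {K : nzRingType} {V : lmodType K}.

Definition elts (U : submodClosed V) : Type := {x : V | x \in U}.
HB.instance Definition _ U := SubChoice.on (elts U).
HB.instance Definition _ U := [SubChoice_isSubLmodule of elts U by <:].

Definition as_zmod (U : submodClosed V) : pred V := fun x => x \in U.
HB.instance Definition _ U :=
  GRing.isSubmodClosed.Build K V (as_zmod U) (GRing.subsemimodClosedP U).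

Definition vquot (U : submodClosed V) : Type :=
  Quotient.quot (GRing.ZmodClosed.clone V (as_zmod U) _).
HB.instance Definition _ U := GRing.Zmodule.on (vquot U).
HB.instance Definition _ U := EqQuotient.on (vquot U).

Section QuotientScale.
Variable U : submodClosed V.

Definition vquot_scale (c : K) (x : vquot U) : vquot U :=
  \pi_(vquot U) (c *: repr x).

Lemma vquot_eq (x y : V) :
  \pi_(vquot U) x = \pi_(vquot U) y <-> x - y \in U.
Proof. by split=> [/eqP|h]; [|apply/eqP]; rewrite -Quotient.idealrBE. Qed.

Lemma vquot_scaleE c x : vquot_scale c (\pi x) = \pi_(vquot U) (c *: x).
Proof.
apply/vquot_eq; rewrite -scalerBr rpredZ //; apply/vquot_eq.
by rewrite reprK.
Qed.

Lemma vquotD (x y : V) :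
  \pi_(vquot U) (x + y) = \pi_(vquot U) x + \pi_(vquot U) y :> vquot U.
Proof. exact: (raddfD (\pi_(Quotient.quot (GRing.ZmodClosed.clone V (as_zmod U) _)))). Qed.

Fact vquot_scaleA a b x :
  vquot_scale a (vquot_scale b x) = vquot_scale (a * b) x.
Proof. by elim/quotW: x => x; rewrite !vquot_scaleE scalerA. Qed.
Fact vquot_scale1 : left_id 1 vquot_scale.
Proof. by elim/quotW=> x; rewrite vquot_scaleE scale1r. Qed.
Fact vquot_scaleDr : right_distributive vquot_scale +%R.
Proof.
move=> a; elim/quotW=> x; elim/quotW=> y.
by rewrite -vquotD !vquot_scaleE -vquotD scalerDr.
Qed.
Fact vquot_scaleDl v : {morph vquot_scale^~ v : a b / a + b}.
Proof. by elim/quotW: v => x a b; rewrite !vquot_scaleE -vquotD scalerDl. Qed.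

HB.instance Definition _ := GRing.Zmodule_isLmodule.Build K (vquot U)
  vquot_scaleA vquot_scale1 vquot_scaleDr vquot_scaleDl.
End QuotientScale.

Definition lspan (P : V -> Prop) : pred V := fun x =>
  `[< exists s : seq (K * V),
        {in s, forall p, P p.2} /\ x = \sum_(p <- s) p.1 *: p.2 >].

Fact lspan_closed P : submod_closed (lspan P).
Proof.
split; first by apply/asboolP; exists [::]; rewrite big_nil.
move=> a u v /asboolP[s [Ps ->]] /asboolP[t [Pt ->]]; apply/asboolP.
exists ([seq (a * p.1, p.2) | p <- s] ++ t); split.
  by move=> p; rewrite mem_cat => /orP[/mapP[q /Ps ? ->]|/Pt].
rewrite big_cat big_map scaler_sumr; congr (_ + _).
by apply: eq_bigr => p _; rewrite scalerA.
Qed.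
HB.instance Definition _ P :=
  GRing.isSubmodClosed.Build K V (lspan P) (GRing.submod_closed_semi (lspan_closed P)).
Definition spanned (P : V -> Prop) : submodClosed V :=
  GRing.SubmodClosed.clone K V (lspan P) _.

End Subspaces.

(* The tensor product of M and N over K, balanced over a set B acting on the
   right of M and on the left of N: formal sums of pairs, two of them being
   identified when every K-bilinear B-balanced map takes the same value on
   both.  For B a K-algebra this is M (x)_B N with its K-space structure. *)

Section Tensor.
Context {K : comNzRingType} {M N : lmodType K} {B : Type}.
Variables (ra : M -> B -> M) (la : B -> N -> N).

Definition balanced (V : lmodType K) (f : M -> N -> V) : Prop :=
  [/\ forall n, linear (f ^~ n), forall m, linear (f m)
    & forall m b n, f (ra m b) n = f m (la b n)].

Definition tens_rel (s t : seq (M * N)) : bool :=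
  `[< forall (V : lmodType K) (f : M -> N -> V), balanced f ->
        \sum_(p <- s) f p.1 p.2 = \sum_(p <- t) f p.1 p.2 >].

Fact tens_rel_equiv : equiv_class_of tens_rel.
Proof.
split=> [s|s t|t s u]; first by apply/asboolP.
- by apply/asboolP/asboolP => h V f /h.
- by move=> /asboolP h1 /asboolP h2; apply/asboolP => V f bf; rewrite h1 // h2.
Qed.
Canonical tens_equiv := EquivRelPack tens_rel_equiv.
Canonical tens_encModRel := defaultEncModRel tens_rel.

Definition tens : Type := {eq_quot tens_equiv}.
HB.instance Definition _ := Choice.on tens.
HB.instance Definition _ := EqQuotient.on tens.

Definition pure (m : M) (n : N) : tens := \pi_tens [:: (m, n)].

(* A map given on pure tensors: "x |-> f x_(1) x_(2)".  It does not depend on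
   the representative of x as soon as f is balanced (tlift_pi). *)
Definition tlift (V : nmodType) (f : M -> N -> V) (x : tens) : V :=
  \sum_(p <- repr x) f p.1 p.2.

Lemma tlift_pi (V : lmodType K) (f : M -> N -> V) s : balanced f ->
  tlift f (\pi s) = \sum_(p <- s) f p.1 p.2.
Proof.
move=> bf; have /eqP/eqquotP/asboolP h : \pi_tens (repr (\pi_tens s)) == \pi s.
  by rewrite reprK.
exact: h.
Qed.

Lemma tlift_pure (V : lmodType K) (f : M -> N -> V) m n : balanced f ->
  tlift f (pure m n) = f m n.
Proof. by move=> bf; rewrite tlift_pi // big_seq1. Qed.

Lemma tens_ext (x y : tens) :
  (forall (V : lmodType K) (f : M -> N -> V), balanced f ->
     tlift f x = tlift f y) -> x = y.
Proof.
elim/quotW: x => s; elim/quotW: y => t h; apply/eqquotP/asboolP => V f bf.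
by rewrite -!tlift_pi // h.
Qed.

Definition tadd (x y : tens) : tens := \pi_tens (repr x ++ repr y).
Definition topp (x : tens) : tens := \pi_tens [seq (- p.1, p.2) | p <- repr x].
Definition tscale (c : K) (x : tens) : tens :=
  \pi_tens [seq (c *: p.1, p.2) | p <- repr x].
Definition tzero : tens := \pi_tens [::].

Section TliftE.
Variables (V : lmodType K) (f : M -> N -> V) (bf : balanced f).

Let fZl c m n : f (c *: m) n = c *: f m n.
Proof.
have [/(_ n) lf _ _] := bf.
have f0 : f 0 n = 0.
  have /= := lf (-1) 0 0; rewrite scaleN1r oppr0 addr0.
  by rewrite scaleN1r addNr.
by have /= := lf c m 0; rewrite !addr0 f0 addr0.
Qed.

Lemma tliftD x y : tlift f (tadd x y) = tlift f x + tlift f y.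
Proof. by rewrite tlift_pi // big_cat. Qed.
Lemma tlift0 : tlift f tzero = 0.
Proof. by rewrite tlift_pi // big_nil. Qed.
Lemma tliftZ c x : tlift f (tscale c x) = c *: tlift f x.
Proof.
rewrite tlift_pi // big_map scaler_sumr.
by apply: eq_bigr => p _ /=; rewrite fZl.
Qed.
Lemma tliftN x : tlift f (topp x) = - tlift f x.
Proof.
rewrite -scaleN1r -tliftZ !tlift_pi // !big_map.
by apply: eq_bigr => p _ /=; rewrite scaleN1r.
Qed.
End TliftE.

Fact taddA : associative tadd.
Proof. by move=> x y z; apply: tens_ext => V f bf; rewrite !tliftD // addrA. Qed.
Fact taddC : commutative tadd.
Proof. by move=> x y; apply: tens_ext => V f bf; rewrite !tliftD // addrC. Qed.
Fact tadd0 : left_id tzero tadd.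
Proof. by move=> x; apply: tens_ext => V f bf; rewrite tliftD // tlift0 // add0r. Qed.
Fact taddN : left_inverse tzero topp tadd.
Proof.
move=> x; apply: tens_ext => V f bf.
by rewrite tliftD // tliftN // tlift0 // addNr.
Qed.
HB.instance Definition _ := GRing.isZmodule.Build tens taddA taddC tadd0 taddN.

Fact tscaleA a b x : tscale a (tscale b x) = tscale (a * b) x.
Proof. by apply: tens_ext => V f bf; rewrite !tliftZ // scalerA. Qed.
Fact tscale1 : left_id 1 tscale.
Proof. by move=> x; apply: tens_ext => V f bf; rewrite tliftZ // scale1r. Qed.
Fact tscaleDr : right_distributive tscale +%R.
Proof.
by move=> a x y; apply: tens_ext => V f bf; rewrite !(tliftZ, tliftD) // scalerDr.
Qed.
Fact tscaleDl x : {morph tscale^~ x : a b / a + b}.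
Proof.
by move=> a b; apply: tens_ext => V f bf; rewrite !(tliftZ, tliftD) // scalerDl.
Qed.
HB.instance Definition _ := GRing.Zmodule_isLmodule.Build K tens
  tscaleA tscale1 tscaleDr tscaleDl.

Lemma tlift_linear (V : lmodType K) (f : M -> N -> V) :
  balanced f -> linear (tlift f).
Proof. by move=> bf c x y; rewrite tliftD // tliftZ. Qed.

Lemma pure_balanced : balanced pure.
Proof.
split=> [n c m m'|m c n n'|m b n]; apply: tens_ext => V f bf;
  rewrite ?(tliftD, tliftZ, tlift_pure) //; case: bf => [h1 h2 h3].
- exact: h1.
- exact: h2.
- exact: h3.
Qed.

Lemma tens_pure (x : tens) : x = tlift pure x.
Proof.
apply: tens_ext => V f bf; rewrite [in RHS]/(tlift pure x) [LHS]/tlift.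
elim: (repr x) => [|p s IHs]; first by rewrite !big_nil (tlift0 bf).
by rewrite !big_cons (tliftD bf) tlift_pure // IHs.
Qed.

End Tensor.

Section TensorK.
Context {K : comNzRingType}.

Definition rscale (M : lmodType K) (m : M) (c : K) : M := c *: m.
Definition lscale (M : lmodType K) (c : K) (m : M) : M := c *: m.

End TensorK.

Notation "M \ox N" := (tens (@rscale _ M) (@lscale _ N))
  (at level 40, left associativity) : type_scope.
Notation "m \ox n" := (pure (@rscale _ _) (@lscale _ _) m n)
  (at level 40, left associativity) : ring_scope.

Lemma tens_sum (K : comNzRingType) (M N : lmodType K) (x : M \ox N) :
  exists s : seq (M * N), x = \sum_(p <- s) p.1 \ox p.2.
Proof. by exists (repr x); rewrite {1}[x]tens_pure. Qed.

(* Restriction of scalars along a ring morphism; it makes tlift usable for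
   antilinear maps. *)
Section Twist.
Context {K : nzRingType}.
Definition twist (sigma : {rmorphism K -> K}) (V : lmodType K) : Type := V.
HB.instance Definition _ sigma V := GRing.Zmodule.on (twist sigma V).
Variables (sigma : {rmorphism K -> K}) (V : lmodType K).
Definition twist_scale (c : K) (v : twist sigma V) : twist sigma V := (sigma c *: (v : V)).
Fact twist_scaleA a b v :
  twist_scale a (twist_scale b v) = twist_scale (a * b) v.
Proof. by rewrite /twist_scale scalerA rmorphM. Qed.
Fact twist_scale1 : left_id 1 twist_scale.
Proof. by move=> v; rewrite /twist_scale rmorph1 scale1r. Qed.
Fact twist_scaleDr : right_distributive twist_scale +%R.
Proof. by move=> a u v; rewrite /twist_scale scalerDr. Qed.
Fact twist_scaleDl v : {morph twist_scale^~ v : a b / a + b}.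
Proof. by move=> a b; rewrite /twist_scale rmorphD scalerDl. Qed.
HB.instance Definition _ := GRing.Zmodule_isLmodule.Build K (twist sigma V)
  twist_scaleA twist_scale1 twist_scaleDr twist_scaleDl.
End Twist.

Section TensorAlgebra.
Context {K : comNzRingType}.

Definition tmap (M M' N N' : lmodType K) (f : M -> M') (g : N -> N')
    (x : M \ox N) : M' \ox N' := tlift (fun m n => f m \ox g n) x.

Definition tmul (A A' : algType K) (x y : A \ox A') : A \ox A' :=
  tlift (fun a a' => tlift (fun b b' => (a * b) \ox (a' * b')) y) x.

Lemma tensDl (M N : lmodType K) (n : N) : linear (fun m : M => m \ox n).
Proof. by case: (pure_balanced (@rscale K M) (@lscale K N)) => h _ _ c x y; exact: h. Qed.
Lemma tensDr (M N : lmodType K) (m : M) : linear (fun n : N => m \ox n).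
Proof. by case: (pure_balanced (@rscale K M) (@lscale K N)) => _ h _ c x y; exact: h. Qed.
Lemma tensZ (M N : lmodType K) c (m : M) (n : N) : (c *: m) \ox n = m \ox (c *: n).
Proof. by case: (pure_balanced (@rscale K M) (@lscale K N)) => _ _ h; exact: h. Qed.

Lemma tmap_balanced (M M' N N' : lmodType K) (f : M -> M') (g : N -> N') :
  linear f -> linear g ->
  balanced (@rscale K M) (@lscale K N) (fun m n => f m \ox g n).
Proof.
move=> lf lg; split=> [n c x y|m c x y|m c n].
- by rewrite lf tensDl.
- by rewrite lg tensDr.
- have := lf c m 0; have := lg c n 0; rewrite !addr0 /rscale /lscale => -> ->.
  have f0 : f 0 = 0 by have := lf (-1) 0 0; rewrite !scaleN1r oppr0 addr0 addNr.
  have g0 : g 0 = 0 by have := lg (-1) 0 0; rewrite !scaleN1r oppr0 addr0 addNr.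
  by rewrite f0 g0 !addr0 tensZ.
Qed.

Lemma tmap_linear (M M' N N' : lmodType K) (f : M -> M') (g : N -> N') :
  linear f -> linear g -> linear (tmap f g).
Proof. by move=> lf lg; exact: (tlift_linear (tmap_balanced lf lg)). Qed.
Lemma tmap_pure (M M' N N' : lmodType K) (f : M -> M') (g : N -> N') m n :
  linear f -> linear g -> tmap f g (m \ox n) = f m \ox g n.
Proof. by move=> lf lg; rewrite [LHS]tlift_pure //; exact: tmap_balanced. Qed.

Section Tmul.
Variables A A' : algType K.

Let mul_balanced (a : A) (a' : A') : balanced (@rscale K A) (@lscale K A')
  (fun b b' => (a * b) \ox (a' * b')).
Proof.
apply: (@tmap_balanced _ _ _ _ ( *%R a) ( *%R a')).
  by move=> c x y; rewrite mulrDr scalerAr.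
by move=> c x y; rewrite mulrDr scalerAr.
Qed.

Let tmul_balanced (y : A \ox A') : balanced (@rscale K A) (@lscale K A')
  (fun a a' => tlift (fun b b' => (a * b) \ox (a' * b')) y).
Proof.
split=> [a' c a b|a c a' b'|a c a']; rewrite /tlift ?scaler_sumr -?big_split;
  apply: eq_bigr => p _ /=.
- by rewrite mulrDl -scalerAl tensDl.
- by rewrite mulrDl -scalerAl tensDr.
- by rewrite /rscale /lscale -!scalerAl tensZ.
Qed.

Lemma tmul_linearl (y : A \ox A') : linear (fun x => tmul x y).
Proof. exact: tlift_linear (tmul_balanced y). Qed.

Lemma tmul_linearr (x : A \ox A') : linear (tmul x).
Proof.
move=> c y z; rewrite /tmul /tlift scaler_sumr -big_split.
by apply: eq_bigr => p _ /=; exact: tlift_linear (mul_balanced _ _) c y z.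
Qed.

Lemma tmul_pure a a' b b' :
  tmul (a \ox a') (b \ox b') = (a * b) \ox (a' * b') :> (A \ox A').
Proof. by rewrite [LHS](tlift_pure _ _ (tmul_balanced _)) tlift_pure. Qed.

End Tmul.

Lemma linear_sum (U V : lmodType K) (f : U -> V) (I : Type) (s : seq I) (F : I -> U) :
  linear f -> f (\sum_(i <- s) F i) = \sum_(i <- s) f (F i).
Proof.
move=> lf; pose fl := HB.pack_for {linear U -> V} f (GRing.isLinear.Build _ _ _ _ f lf).
exact: (linear_sum fl).
Qed.

End TensorAlgebra.


Section HopfStar.
Variable R : realType.
Local Notation C := R[i].

Definition star_op (A : algType C) (st : A -> A) : Prop :=
  [/\ forall (c : C) x y, st (c *: x + y) = c^* *: st x + st y,
      involutive st
    & forall x y, st (x * y) = st y * st x].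

Record hopfStarAlg := HopfStarAlg {
  hcar :> algType C;
  hstar : hcar -> hcar;
  hdelta : {linear hcar -> (hcar \ox hcar)%type};
  heps : {lrmorphism hcar -> C | *%R};
  hanti : {linear hcar -> hcar};
  hcoassoc : forall a,
    tlift (fun x y => tlift (fun y1 y2 => x \ox (y1 \ox y2)) (hdelta y))
      (hdelta a)
    = tlift (fun x y => tlift (fun x1 x2 => x1 \ox (x2 \ox y)) (hdelta x))
      (hdelta a);
  hcounitl : forall a, tlift (fun x y => heps x *: y) (hdelta a) = a;
  hcounitr : forall a, tlift (fun x y => heps y *: x) (hdelta a) = a;
  hdelta1 : hdelta 1 = 1 \ox 1;
  hdeltaM : forall a b, hdelta (a * b) = tmul (hdelta a) (hdelta b);
  hantil : forall a, tlift (fun x y => hanti x * y) (hdelta a) = (heps a)%:A;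
  hantir : forall a, tlift (fun x y => x * hanti y) (hdelta a) = (heps a)%:A;
  hanti_bij : bijective hanti;
  hstarP : star_op hstar;
  hdelta_star : forall a, hdelta (hstar a) = tmap hstar hstar (hdelta a);
  heps_star : forall a, heps (hstar a) = (heps a)^*
}.

Record hopfStarMap (A H : hopfStarAlg) := HopfStarMap {
  hmap :> {lrmorphism A -> H};
  hmap_delta : forall a, hdelta H (hmap a) = tmap hmap hmap (hdelta A a);
  hmap_eps : forall a, heps H (hmap a) = heps A a;
  hmap_anti : forall a, hmap (hanti A a) = hanti H (hmap a);
  hmap_star : forall a, hmap (hstar a) = hstar (hmap a)
}.

Definition is_coaction (A : hopfStarAlg) (V : lmodType C)
    (co : V -> A \ox V) : Prop :=
  [/\ linear co,
      forall v,
        tlift (fun a w => tlift (fun a' w' => a \ox (a' \ox w')) (co w)) (co v)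
        = tlift (fun a w =>
            tlift (fun a1 a2 => a1 \ox (a2 \ox w)) (hdelta A a)) (co v)
    & forall v, tlift (fun a w => heps A a *: w) (co v) = v].

(* The corestriction of t along an injection incl of W into V; meaningful when
   t lies in A (x) incl(W), in which case it is unique. *)
Definition corestr (A : hopfStarAlg) (V W : lmodType C) (incl : W -> V)
    (t : A \ox V) : A \ox W :=
  xget 0 [set t' : A \ox W | tmap idfun incl t' = t].

Definition subcomodule (A : hopfStarAlg) (V : lmodType C)
    (co : V -> A \ox V) (U : submodClosed V) : Prop :=
  forall v, v \in U -> exists t : A \ox elts U, tmap idfun val t = co v.

Section StarTensor.
Variables (A A' : algType C) (st : A -> A) (st' : A' -> A').
Hypotheses (stP : star_op st) (stP' : star_op st').

Lemma tmap_star_balanced : balanced (@rscale C A) (@lscale C A')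
  (fun a a' => st a \ox st' a' : twist (Num.conj : {rmorphism C -> C}) (A \ox A')%type).
Proof.
have [ls _ _] := stP; have [ls' _ _] := stP'.
have sZ c x : st (c *: x) = c^* *: st x.
  have s0 : st 0 = 0.
    have := ls (-1) 0 0; rewrite scaler0 addr0 rmorphN1 scaleN1r => ->.
    by rewrite addNr.
  by have := ls c x 0; rewrite s0 !addr0.
have sZ' c x : st' (c *: x) = c^* *: st' x.
  have s0 : st' 0 = 0.
    have := ls' (-1) 0 0; rewrite scaler0 addr0 rmorphN1 scaleN1r => ->.
    by rewrite addNr.
  by have := ls' c x 0; rewrite s0 !addr0.
split=> [n c x y|m c x y|m c n].
- by rewrite ls tensDl.
- by rewrite ls' tensDr.
- by rewrite /rscale /lscale sZ sZ' tensZ.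
Qed.
End StarTensor.

Section QHS.
Variables (A H : hopfStarAlg) (pi : hopfStarMap A H).

Definition coinv : pred A := fun a =>
  `[< tlift (fun x y => x \ox pi y) (hdelta A a) = a \ox 1 >].

Let idpi : A \ox A -> A \ox H := tlift (fun x y => x \ox pi y).
Let idpi_bal : balanced (@rscale C A) (@lscale C A) (fun x y => x \ox pi y).
Proof. by apply: (@tmap_balanced _ _ _ _ _ idfun pi) => // c x y; rewrite linearP. Qed.
Let idpiL : linear idpi. Proof. exact: tlift_linear idpi_bal. Qed.
Let idpi_pure x y : idpi (x \ox y) = x \ox pi y.
Proof. exact: tlift_pure idpi_bal. Qed.

Let idpiM x y : idpi (tmul x y) = tmul (idpi x) (idpi y).
Proof.
have [s ->] := tens_sum x; have [t ->] := tens_sum y.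
rewrite (linear_sum _ _ (tmul_linearl _)) !(linear_sum _ _ idpiL).
rewrite (linear_sum _ _ (tmul_linearl _)); apply: eq_bigr => p _.
rewrite !(linear_sum _ _ (tmul_linearr _)) !(linear_sum _ _ idpiL).
apply: eq_bigr => q _.
by rewrite tmul_pure !idpi_pure rmorphM tmul_pure.
Qed.

Fact coinv_closed : subalg_closed coinv.
Proof.
split; first by apply/asboolP; rewrite hdelta1 -/idpi idpi_pure rmorph1.
- move=> c x y /asboolP hx /asboolP hy; apply/asboolP.
  by rewrite linearP -/idpi idpiL /idpi hx hy tensDl.
- move=> x y /asboolP hx /asboolP hy; apply/asboolP.
  by rewrite hdeltaM -/idpi idpiM /idpi hx hy tmul_pure mulr1.
Qed.
HB.instance Definition _ :=
  GRing.isSubalgClosed.Build C A coinv (GRing.subalg_closed_semi coinv_closed).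

Definition qhs : Type := {a : A | a \in coinv}.
HB.instance Definition _ := SubChoice.on qhs.
HB.instance Definition _ := [SubChoice_isSubAlgebra of qhs by <:].

Fact coinv_star a : a \in coinv -> hstar a \in coinv.
Proof.
move=> /asboolP ha; apply/asboolP; rewrite -/idpi hdelta_star.
have bA := tmap_star_balanced (hstarP A) (hstarP A).
have bH := tmap_star_balanced (hstarP A) (hstarP H).
have key z : idpi (tmap (@hstar A) (@hstar A) z)
             = tmap (@hstar A) (@hstar H) (idpi z).
  have [s ->] := tens_sum z.
  pose V := twist (Num.conj : {rmorphism C -> C}) (A \ox A)%type.
  pose W := twist (Num.conj : {rmorphism C -> C}) (A \ox H)%type.
  have sA : tmap (@hstar A) (@hstar A) (\sum_(p <- s) p.1 \ox p.2) =
    \sum_(p <- s) tmap (@hstar A) (@hstar A) (p.1 \ox p.2).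
    exact: (@linear_sum _ _ V _ _ s _ (tlift_linear bA)).
  rewrite sA !(linear_sum _ _ idpiL).
  have sH : tmap (@hstar A) (@hstar H) (\sum_(p <- s) idpi (p.1 \ox p.2)) =
    \sum_(p <- s) tmap (@hstar A) (@hstar H) (idpi (p.1 \ox p.2)).
    exact: (@linear_sum _ _ W _ _ s _ (tlift_linear bH)).
  rewrite sH; apply: eq_bigr => p _; rewrite idpi_pure.
  rewrite [tmap _ _ (p.1 \ox p.2)](@tlift_pure _ _ _ _ _ _ V _ _ _ bA).
  rewrite [tmap _ _ (p.1 \ox pi _)](@tlift_pure _ _ _ _ _ _ W _ _ _ bH).
  by rewrite idpi_pure hmap_star.
rewrite key /idpi ha.
pose W := twist (Num.conj : {rmorphism C -> C}) (A \ox H)%type.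
rewrite [LHS](@tlift_pure _ _ _ _ _ _ W _ _ _ bH).
have [_ sK sM] := hstarP H.
have -> // : hstar (1 : H) = 1.
by rewrite -[LHS]mulr1 -{2}[1]sK -sM mulr1 sK.
Qed.

Definition qstar (b : qhs) : qhs := exist _ (hstar (val b)) (coinv_star (valP b)).
End QHS.
End HopfStar.

(* Compact quantum groups in the sense of Woronowicz: a unital C*-algebra G
   with a coassociative unital *-homomorphism into the minimal tensor product
   of G with itself satisfying the density (cancellation) conditions. *)

Section CompactQuantumGroups.
Variable R : realType.
Local Notation C := R[i].

Definition cstar_norm (V : lmodType C) (mul : V -> V -> V) (st : V -> V)
    (nrm : V -> R) : Prop :=
  [/\ forall x, nrm x = 0 -> x = 0,
      forall x y, nrm (x + y) <= nrm x + nrm y,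
      forall (c : C) x, nrm (c *: x) = complex.Re `|c| * nrm x,
      forall x y, nrm (mul x y) <= nrm x * nrm y
    & forall x, nrm (mul (st x) x) = nrm x ^+ 2].

Record cstarAlg := CstarAlg {
  cscar :> algType C;
  csstar : cscar -> cscar;
  csnorm : cscar -> R;
  csstarP : star_op csstar;
  csnormP : cstar_norm *%R csstar csnorm;
  cscomplete : forall u : nat -> cscar,
    (forall e, 0 < e -> exists N, forall m n, (N <= m)%N -> (N <= n)%N ->
       csnorm (u m - u n) < e) ->
    exists l, forall e, 0 < e -> exists N, forall n, (N <= n)%N ->
      csnorm (u n - l) < e
}.

(* T, with j, is the minimal C*-tensor product of G1 and G2: the completion of
   the algebraic tensor product for its least C*-norm. *)
Definition min_tensor (G1 G2 T : cstarAlg) (j : G1 \ox G2 -> T) : Prop :=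
  [/\ [/\ linear j, injective j, j (1 \ox 1) = 1,
          forall x y, j (tmul x y) = j x * j y
        & forall x, j (tmap (@csstar G1) (@csstar G2) x) = csstar (j x)],
      forall t e, 0 < e -> exists x, csnorm (t - j x) < e
    & forall nrm : G1 \ox G2 -> R,
        cstar_norm (@tmul _ G1 G2) (tmap (@csstar G1) (@csstar G2)) nrm ->
        forall x, csnorm (j x) <= nrm x].

Record compactQG := CompactQG {
  qg :> cstarAlg;
  qg2 : cstarAlg;
  qg3 : cstarAlg;
  qgj : qg \ox qg -> qg2;
  qgj1 : qg2 \ox qg -> qg3;
  qgj2 : qg \ox qg2 -> qg3;
  qgjP : min_tensor qgj;
  qgj1P : min_tensor qgj1;
  qgj2P : min_tensor qgj2;
  qgjA : forall a b c, qgj1 (qgj (a \ox b) \ox c) = qgj2 (a \ox qgj (b \ox c));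
  qgdelta : {lrmorphism qg -> qg2};
  qgdelta_star : forall a, qgdelta (csstar a) = csstar (qgdelta a);
  (* the extensions of Delta (x) id and id (x) Delta to the completion *)
  qgdelta_id : {lrmorphism qg2 -> qg3};
  qgid_delta : {lrmorphism qg2 -> qg3};
  qgdelta_id_star : forall x, qgdelta_id (csstar x) = csstar (qgdelta_id x);
  qgid_delta_star : forall x, qgid_delta (csstar x) = csstar (qgid_delta x);
  qgdelta_idE : forall a b, qgdelta_id (qgj (a \ox b)) = qgj1 (qgdelta a \ox b);
  qgid_deltaE : forall a b, qgid_delta (qgj (a \ox b)) = qgj2 (a \ox qgdelta b);
  qgcoassoc : forall a, qgdelta_id (qgdelta a) = qgid_delta (qgdelta a);
  qgdense_l : forall t e, 0 < e -> exists s : seq (qg * qg),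
    csnorm (t - \sum_(p <- s) qgj (p.1 \ox 1) * qgdelta p.2) < e;
  qgdense_r : forall t e, 0 < e -> exists s : seq (qg * qg),
    csnorm (t - \sum_(p <- s) qgj (1 \ox p.1) * qgdelta p.2) < e
}.

Definition unitary_corep (G : compactQG) n (u : 'M[G]_n) : Prop :=
  let ustar := (map_mx (@csstar G) u)^T in
  [/\ u *m ustar = 1%:M, ustar *m u = 1%:M
    & forall i j, qgdelta G (u i j) = qgj (\sum_(k < n) u i k \ox u k j)].

(* No invariant subspace but the trivial ones; a subspace is given as the
   range of an idempotent matrix. *)
Definition irreducible_corep (G : compactQG) n (u : 'M[G]_n) : Prop :=
  (0 < n)%N /\
  forall P : 'M[C]_n, P *m P = P ->
    let PG := map_mx (fun c => c%:A : G) P in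
    PG *m u *m PG = u *m PG -> P = 0 \/ P = 1%:M.

Definition matrix_coeff (G : compactQG) (x : G) : Prop :=
  exists n (u : 'M[G]_n) i j,
    [/\ unitary_corep u, irreducible_corep u & x = u i j].

Definition cqg_algebra (H : hopfStarAlg R) : Prop :=
  exists (G : compactQG) (f : {lrmorphism H -> G}),
    [/\ injective f,
        forall h, f (hstar h) = csstar (f h),
        forall h, qgdelta G (f h) = qgj (tmap f f (hdelta H h))
      & forall x, (exists h, f h = x) <-> x \in spanned (@matrix_coeff G)].

End CompactQuantumGroups.

Section Modules.
Variable R : realType.
Local Notation C := R[i].

Definition left_module (B : algType C) (M : lmodType C) (la : B -> M -> M) :
    Prop :=
  [/\ forall b, linear (la b), forall m, linear (la ^~ m),
      forall m, la 1 m = m & forall a b m, la (a * b) m = la a (la b m)].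

Definition right_module (B : algType C) (M : lmodType C) (ra : M -> B -> M) :
    Prop :=
  [/\ forall b, linear (ra ^~ b), forall m, linear (ra m),
      forall m, ra m 1 = m & forall a b m, ra m (a * b) = ra (ra m a) b].

Definition exact_at (L M N : lmodType C) (f : L -> M) (g : M -> N) : Prop :=
  forall y, g y = 0 <-> exists x, f x = y.

(* P is a right B-module through ra. *)
Definition faithfully_flat_right (B : algType C) (P : lmodType C)
    (ra : P -> B -> P) : Prop :=
  forall (L M N : lmodType C)
    (laL : B -> L -> L) (laM : B -> M -> M) (laN : B -> N -> N)
    (f : {linear L -> M}) (g : {linear M -> N}),
  left_module laL -> left_module laM -> left_module laN ->
  (forall b x, f (laL b x) = laM b (f x)) ->
  (forall b x, g (laM b x) = laN b (g x)) ->
  (exact_at f g <->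
   exact_at (tlift (fun p x => pure ra laM p (f x)) : tens ra laL -> tens ra laM)
         (tlift (fun p x => pure ra laN p (g x)) : tens ra laM -> tens ra laN)).

End Modules.

Section RelativeBimodules.
Variables (R : realType) (A H : hopfStarAlg R) (pi : hopfStarMap A H).
Local Notation C := R[i].
Local Notation B := (qhs pi).

(* The coaction of A on B, i.e. the restriction of Delta. *)
Definition qdelta (b : B) : A \ox B := corestr val (hdelta A (val b)).

(* A vector space with the operations of an object of the category of
   A-covariant B-bimodules; the axioms are in covariant_bimodule. *)
Record covBimod := CovBimod {
  bcar :> lmodType C;
  bl : B -> bcar -> bcar;
  br : bcar -> B -> bcar;
  bco : bcar -> A \ox bcar
}.

Definition covariant_bimodule (M : covBimod) : Prop :=
  [/\ left_module (@bl M), right_module (@br M),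
      forall b c (m : M), bl b (br m c) = br (bl b m) c,
      is_coaction (@bco M)
    & forall b c (m : M), bco (bl b (br m c)) =
        tlift (fun b1 b2 => tlift (fun m1 m0 => tlift (fun c1 c2 =>
          (b1 * m1 * c1) \ox bl b2 (br m0 c2)) (qdelta c)) (bco m)) (qdelta b)].

Definition cov_morphism (M N : covBimod) (f : M -> N) : Prop :=
  [/\ linear f, forall b m, f (bl b m) = bl b (f m),
      forall b m, f (br m b) = br (f m) b
    & forall m, bco (f m) = tmap idfun f (bco m)].

Definition cov_unit : covBimod :=
  @CovBimod B (fun b c => b * c) (fun b c => b * c) qdelta.

Definition cov_tens (M N : covBimod) : covBimod :=
  @CovBimod (tens (@br M) (@bl N))
    (fun b => tlift (fun m n => pure (@br M) (@bl N) (bl b m) n))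
    (fun x b => tlift (fun m n => pure (@br M) (@bl N) m (br n b)) x)
    (tlift (fun m n => tlift (fun m1 m0 => tlift (fun n1 n0 =>
       (m1 * n1) \ox pure (@br M) (@bl N) m0 n0) (bco n)) (bco m))).

Definition pureB (M N : covBimod) (m : M) (n : N) : cov_tens M N :=
  pure (@br M) (@bl N) m n.

Definition tmapB (M M' N N' : covBimod) (f : M -> M') (g : N -> N') :
    cov_tens M N -> cov_tens M' N' :=
  tlift (fun m n => pureB (f m) (g n)).

Definition augl (M : covBimod) : submodClosed M :=
  spanned (fun x : M => exists b m, heps A (val b) = 0 /\ x = bl b m).
Definition augr (M : covBimod) : submodClosed M :=
  spanned (fun x : M => exists b m, heps A (val b) = 0 /\ x = br m b).

Definition fin_gen_left (M : covBimod) : Prop :=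
  exists n (e : 'I_n -> M), forall m, exists b : 'I_n -> B,
    m = \sum_(i < n) bl (b i) (e i).

Definition mod0 (M : covBimod) : Prop :=
  [/\ covariant_bimodule M, fin_gen_left M & augr M =i augl M].

(* Maps out of Phi M are given on chosen representatives; they are the maps
   induced on M/(B^+ M) whenever these exist. *)
Definition Phi (M : covBimod) : lmodType C := vquot (augl M).
Definition cls (M : covBimod) (m : M) : Phi M := \pi_(vquot (augl M)) m.
Definition rep (M : covBimod) (u : Phi M) : M := repr (u : vquot (augl M)).

Definition Phi_co (M : covBimod) (u : Phi M) : H \ox Phi M :=
  tlift (fun a m => pi a \ox cls m) (bco (rep u)).

Definition Phi_map (M N : covBimod) (f : M -> N) (u : Phi M) : Phi N :=
  cls (f (rep u)).

(* [m] (x) [n] |-> [m (x) n] *)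
Definition Phi_tens (M N : covBimod) : Phi M \ox Phi N -> Phi (cov_tens M N) :=
  tlift (fun u v => cls (pureB (rep u) (rep v))).

Definition Phi_unit (u : Phi cov_unit) : C := heps A (val (rep u)).

Definition inner_product (V : lmodType C) (ip : V -> V -> C) : Prop :=
  [/\ forall c u v w, ip (c *: u + v) w = c * ip u w + ip v w,
      forall u v, ip v u = (ip u v)^*
    & forall v, v != 0 -> 0 < ip v v].

Definition invariant_inner_product (M : covBimod) (ip : Phi M -> Phi M -> C) :
    Prop :=
  inner_product ip /\
  forall v w, tlift (fun a v0 => tlift (fun b w0 =>
      ip v0 w0 *: (a * hstar b)) (Phi_co w)) (Phi_co v) = (ip v w)%:A.

Definition orthonormal_basis (V : lmodType C) (ip : V -> V -> C)
    n (v : 'I_n -> V) : Prop :=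
  (forall i j, ip (v i) (v j) = (i == j)%:R) /\
  (forall u, exists c : 'I_n -> C, u = \sum_(i < n) c i *: v i).

(* The last two conditions are ((w, -) (x) id) g = w = (id (x) (-, w)) g. *)
Definition is_metric (M : covBimod) (g : cov_tens M M)
    (met : cov_tens M M -> cov_unit) : Prop :=
  [/\ linear met,
      forall b x, met (bl b x) = bl b (met x),
      forall b x, met (br x b) = br (met x) b,
      forall w, tlift (fun x y => bl (met (pureB w x) : B) y) g = w
    & forall w, tlift (fun x y => br x (met (pureB y w) : B)) g = w].

Definition covariant_metric (M : covBimod) (g : cov_tens M M)
    (met : cov_tens M M -> cov_unit) : Prop :=
  (forall x, bco (met x) = tmap idfun met (bco x)) /\
  (forall b : cov_unit, bco (bl (b : B) g) =
     tmap idfun (fun c : cov_unit => bl (c : B) g) (bco b)).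

Definition dagger (M : covBimod) (st : M -> M) :
    cov_tens M M -> cov_tens M M :=
  tlift (fun x y => pureB (st y) (st x)).

End RelativeBimodules.

Section Calculi.
Variable R : realType.
Local Notation C := R[i].

Definition direct_sum (V : lmodType C) (I : choiceType)
    (U : I -> submodClosed V) : Prop :=
  (forall x, exists (s : seq I) (f : I -> V),
     (forall i, f i \in U i) /\ x = \sum_(i <- s) f i) /\
  (forall (s : seq I) (f : I -> V), uniq s -> (forall i, f i \in U i) ->
     \sum_(i <- s) f i = 0 -> forall i, i \in s -> f i = 0).

(* Omega is a single algebra, with Omega^k the subspace fdeg k; form0
   identifies B with Omega^0, and B acts on forms through it. *)
Record diffCalc (B : algType C) := DiffCalc {
  formalg :> algType C;
  fdeg : nat -> submodClosed formalg;
  form0 : {lrmorphism B -> formalg};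
  extd : {linear formalg -> formalg};
  fdeg_direct : direct_sum fdeg;
  fdegM : forall k l x y,
    x \in fdeg k -> y \in fdeg l -> x * y \in fdeg (k + l)%N;
  form0_inj : injective form0;
  fdeg0 : forall x, x \in fdeg 0 <-> exists b, x = form0 b;
  extd_deg : forall k x, x \in fdeg k -> extd x \in fdeg k.+1;
  extdK : forall x, extd (extd x) = 0;
  extdM : forall k x y, x \in fdeg k ->
    extd (x * y) = extd x * y + (-1) ^+ k * (x * extd y);
  form_gen : forall S : {pred formalg}, subalg_closed S ->
    (forall b, form0 b \in S) -> (forall b, extd (form0 b) \in S) ->
    forall x, x \in S
}.

Record starCalc (B : algType C) (st : B -> B) := StarCalc {
  scalc :> diffCalc B;
  fstar : scalc -> scalc;
  fstarD : forall (c : C) x y, fstar (c *: x + y) = c^* *: fstar x + fstar y;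
  fstarK : involutive fstar;
  fstar_deg : forall k x, x \in fdeg scalc k -> fstar x \in fdeg scalc k;
  fstar_form0 : forall b, fstar (form0 scalc b) = form0 scalc (st b);
  fstar_d : forall x, fstar (extd scalc x) = extd scalc (fstar x);
  fstarM : forall k l x y, x \in fdeg scalc k -> y \in fdeg scalc l ->
    fstar (x * y) = (-1) ^+ (k * l) * (fstar y * fstar x)
}.

Record complexStr (B : algType C) (st : B -> B) (Om : starCalc st) :=
    ComplexStr {
  bideg : nat -> nat -> submodClosed Om;
  bideg_direct : direct_sum (fun pq : nat * nat => bideg pq.1 pq.2);
  bidegM : forall p q r s x y, x \in bideg p q -> y \in bideg r s ->
    x * y \in bideg (p + r) (q + s);
  bideg_total : forall k x, x \in fdeg Om k <-> exists f : nat -> nat -> Om,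
    (forall p q, f p q \in bideg p q) /\ x = \sum_(p < k.+1) f p (k - p)%N;
  bideg_star : forall p q x, x \in bideg p q -> fstar x \in bideg q p;
  bideg_d : forall p q x, x \in bideg p q -> exists y z,
    [/\ y \in bideg p.+1 q, z \in bideg p q.+1 & extd Om x = y + z]
}.

Section Stable.
Variables (B : algType C) (st : B -> B) (Om : starCalc st).

Fact fdeg_l k b (x : Om) : x \in fdeg Om k -> form0 Om b * x \in fdeg Om k.
Proof.
have hb : form0 Om b \in fdeg Om 0 by apply/fdeg0; exists b.
by move=> /(fdegM hb).
Qed.
Fact fdeg_r k b (x : Om) : x \in fdeg Om k -> x * form0 Om b \in fdeg Om k.
Proof.
have hb : form0 Om b \in fdeg Om 0 by apply/fdeg0; exists b.
by move=> /fdegM /(_ hb); rewrite addn0.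
Qed.

Variable cs : complexStr Om.

Fact bideg00 b : form0 Om b \in bideg cs 0 0.
Proof.
have : form0 Om b \in fdeg Om 0 by apply/fdeg0; exists b.
by move=> /(bideg_total cs)[f [hf ->]]; rewrite big_ord1.
Qed.
Fact bideg_l p q b x : x \in bideg cs p q -> form0 Om b * x \in bideg cs p q.
Proof. by move=> /(bidegM (bideg00 b)). Qed.
Fact bideg_r p q b x : x \in bideg cs p q -> x * form0 Om b \in bideg cs p q.
Proof. by move=> /bidegM /(_ (bideg00 b)); rewrite !addn0. Qed.
Fact bideg_sub p q x : x \in bideg cs p q -> x \in fdeg Om (p + q).
Proof.
move=> hx; apply/(bideg_total cs).
exists (fun i j => if (i == p) && (j == q) then x else 0); split=> [i j|].
  by case: ifP => [/andP[/eqP-> /eqP->]//|_]; rewrite rpred0.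
have hp : (p < (p + q).+1)%N by rewrite ltnS leq_addr.
rewrite (bigD1 (Ordinal hp)) //= eqxx addKn eqxx big1 ?addr0 // => i /eqP hi.
by case: eqP => //= e; case: hi; exact: val_inj.
Qed.

End Stable.
End Calculi.

Section CovariantCalculi.
Variables (R : realType) (A H : hopfStarAlg R) (pi : hopfStarMap A H).
Local Notation C := R[i].
Local Notation B := (qhs pi).

Definition sub_bimod (Om : diffCalc B) (co : Om -> A \ox Om)
    (U : submodClosed Om)
    (Ul : forall b x, x \in U -> form0 Om b * x \in U)
    (Ur : forall b x, x \in U -> x * form0 Om b \in U) : covBimod pi :=
  @CovBimod _ _ _ pi (elts U)
    (fun b w => exist _ (form0 Om b * val w) (Ul b _ (valP w)))
    (fun w b => exist _ (val w * form0 Om b) (Ur b _ (valP w)))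
    (fun w => corestr val (co (val w))).

Record covCalc := CovCalc {
  ccalc :> starCalc (@qstar _ _ _ pi);
  fco : {linear ccalc -> (A \ox ccalc)%type};
  fco_coaction : is_coaction fco;
  fco_form0 : forall b, fco (form0 ccalc b) = tmap idfun (form0 ccalc) (qdelta b);
  fcoM : forall x y, fco (x * y) = tmul (fco x) (fco y);
  fco_star : forall x, fco (fstar x) = tmap (@hstar _ A) (@fstar _ _ _ ccalc) (fco x);
  fco_d : forall x, fco (extd ccalc x) = tmap idfun (extd ccalc) (fco x);
  fdeg_subcomodule : forall k, subcomodule fco (fdeg ccalc k);
  fdeg_covariant : forall k, covariant_bimodule
    (sub_bimod fco (@fdeg_l _ _ _ ccalc k) (@fdeg_r _ _ _ ccalc k))
}.

Definition forms (Om : covCalc) (k : nat) : covBimod pi :=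
  sub_bimod (fco Om) (@fdeg_l _ _ _ Om k) (@fdeg_r _ _ _ Om k).

Definition forms_star (Om : covCalc) k (w : forms Om k) : forms Om k :=
  exist _ (fstar (val w)) (fstar_deg (valP w)).

Definition covariant_complex (Om : covCalc) (cs : complexStr Om) : Prop :=
  forall p q, subcomodule (fco Om) (bideg cs p q).

Section Complex.
Variables (Om : covCalc) (cs : complexStr Om).

Definition pqforms (p q : nat) : covBimod pi :=
  sub_bimod (fco Om) (@bideg_l _ _ _ _ cs p q) (@bideg_r _ _ _ _ cs p q).

Definition pqstar p q (w : pqforms p q) : pqforms q p :=
  exist _ (fstar (val w)) (bideg_star (valP w)).

Definition pqincl p q (w : pqforms p q) : forms Om (p + q) :=
  exist _ (val w) (bideg_sub (valP w)).

(* The map [w] |-> [w^*] from Phi(Omega^(p,q)) to Phi(Omega^(q,p)). *)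
Definition Phi_star p q (u : Phi (pqforms p q)) : Phi (pqforms q p) :=
  cls (pqstar (rep u)).

Definition assoc_pairing p q (ip : Phi (pqforms p q) -> Phi (pqforms p q) -> C)
    (f : cov_tens (pqforms p q) (pqforms q p) -> cov_unit pi) : Prop :=
  cov_morphism f /\
  forall u v, Phi_unit (Phi_map f (Phi_tens (u \ox v))) = ip u (Phi_star v).

Definition assoc_coev p q (ip : Phi (pqforms p q) -> Phi (pqforms p q) -> C)
    (cv : cov_unit pi -> cov_tens (pqforms q p) (pqforms p q)) : Prop :=
  cov_morphism cv /\
  exists n (v : 'I_n -> Phi (pqforms p q)), orthonormal_basis ip v /\
    Phi_map cv (cls ((1 : B) : cov_unit pi)) = Phi_tens (\sum_(i < n) Phi_star (v i) \ox v i).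

(* The components of a one-form in Omega^(1,0) and Omega^(0,1). *)
Definition pr10 (w : forms Om 1) : pqforms 1 0 :=
  xget 0 [set u | exists v : pqforms 0 1, val w = val u + val v].
Definition pr01 (w : forms Om 1) : pqforms 0 1 :=
  xget 0 [set v | exists u : pqforms 1 0, val w = val u + val v].

Variable lam : R.

Definition form_metric
    (m10 : cov_tens (pqforms 1 0) (pqforms 0 1) -> cov_unit pi)
    (m01 : cov_tens (pqforms 0 1) (pqforms 1 0) -> cov_unit pi) :
    cov_tens (forms Om 1) (forms Om 1) -> cov_unit pi :=
  tlift (fun w h => m10 (pureB (pr10 w) (pr01 h))
                    - (lam^-1)%:C%C *: m01 (pureB (pr01 w) (pr10 h))).

Definition form_coev
    (cv10 : cov_unit pi -> cov_tens (pqforms 0 1) (pqforms 1 0))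
    (cv01 : cov_unit pi -> cov_tens (pqforms 1 0) (pqforms 0 1))
    (b : cov_unit pi) : cov_tens (forms Om 1) (forms Om 1) :=
  tmapB (@pqincl 0 1) (@pqincl 1 0) (cv10 b)
  - lam%:C%C *: tmapB (@pqincl 1 0) (@pqincl 0 1) (cv01 b).

End Complex.
End CovariantCalculi.

(* Main.v *)
From HB Require Import structures.
Require Import Defs.
From mathcomp Require Import all_boot all_order all_algebra.
From mathcomp Require Import boolp classical_sets reals complex.

Set Implicit Arguments.
Unset Strict Implicit.
Unset Printing Implicit Defensive.

Import Order.TTheory GRing.Theory Num.Theory.
Local Open Scope ring_scope.

(** The pairing and the coevaluation are determined by what they do on the
    fibres M/(B^+ M), and there everything is linear algebra with an
    orthonormal basis.

    The bridge is that M |-> M/(B^+ M) detects elements and hence colinear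
    maps.  In A (x)_B M the element 1 (x) m is recovered from
    m_(-1) (x) [m_(0)] through a (x) [m] |-> a S(m_(-1)) (x) m_(0), which is
    well defined because S(b_(1)) b_(2) = eps(b); and 1 (x) m = 0 forces m = 0
    by faithful flatness of A over B ([one_pure_eq0]).  So m vanishes as soon
    as m_(-1) (x) [m_(0)] does ([coaction_cls_inj]), and a colinear
    endomorphism that fixes every class is the identity ([colinear_id]).

    Let M and N be the forms of bidegree (p,q) and (q,p), with pairing
    m : M (x)_B N -> B and coevaluated element g in N (x)_B M.  Since g is
    coinvariant, w |-> m(w (x) g') g'' and w |-> g' m(g'' (x) w) are colinear
    maps of M and of N; on the fibres they are the expansions
    sum_i <w, v_i> v_i in the orthonormal basis and its conjugate.  Hence both
    are identities ([contract_l_id], [contract_r_id]).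

    Reality of g follows from the same criterion.  The adjoint g^dag is
    coinvariant and has the class of g, because each v_i^* (x) v_i is
    self-adjoint; so contraction with g^dag is also the identity of M.
    Contracting g with g^dag in the two possible ways then gives
    g = g^dag ([dag_id]).

    Finally Omega^1 = Omega^(1,0) + Omega^(0,1), the projections and inclusions
    are morphisms, and the zigzag identities for Omega^1 are those of the two
    summands: on the second one the scalars -lam and -1/lam cancel.  Reality of
    lam is what makes the second summand of g self-adjoint. *)

(** * Linear maps and tensor products over a field *)

Section LinearMaps.
Variable K : nzRingType.
Implicit Types U V W : lmodType K.

Lemma lin_add U V (f : U -> V) : linear f -> {morph f : x y / x + y}.
Proof. by move=> lf x y; have := lf 1 x y; rewrite !scale1r. Qed.

Lemma lin_zero U V (f : U -> V) : linear f -> f 0 = 0.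
Proof.
by move=> lf; apply: (@addrI _ (f 0)); rewrite -(lin_add lf) !addr0.
Qed.

Lemma lin_scale U V (f : U -> V) : linear f -> forall c, {morph f : x / c *: x}.
Proof. by move=> lf c x; have := lf c x 0; rewrite (lin_zero lf) !addr0. Qed.

Lemma lin_sub U V (f : U -> V) : linear f -> {morph f : x y / x - y}.
Proof.
by move=> lf x y; rewrite -scaleN1r (lin_add lf) (lin_scale lf) scaleN1r.
Qed.

Lemma lin_id V : linear (fun x : V => x). Proof. by []. Qed.

Lemma lin_comp U V W (f : V -> W) (g : U -> V) :
  linear f -> linear g -> linear (fun x => f (g x)).
Proof. by move=> lf lg c x y; rewrite lg lf. Qed.

End LinearMaps.

Section GeneralizedInverse.
Variable K : fieldType.

(** Over a field no choice of bases is needed to split a linear map: a maximal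
    linear relation between T and V that is single-valued and sends phi v to
    a preimage of phi v is the graph of s.  This serves both to see that
    tensoring preserves injections and to cut kernels out of a tensor
    product. *)
Lemma generalized_inverse (V T : lmodType K) (phi : V -> T) : linear phi ->
  exists2 s : T -> V, linear s & forall v, phi (s (phi v)) = phi v.
Proof.
move=> lphi.
pose P (G : set (T * V)) :=
  [/\ forall c x y, G x -> G y -> G (c *: x.1 + y.1, c *: x.2 + y.2),
      forall v, G (0, v) -> v = 0
    & forall v v', G (phi v, v') -> phi v' = phi v].
have [|G [[Glin G0 Gphi] Gmax]] := @Zorn_bigcup _ P.
  move=> F FP Ftot; split.
  - move=> c x y [X FX Xx] [Y FY Yy].
    have [XY|YX] := Ftot _ _ FX FY.
      by exists Y => //; have [h _ _] := FP _ FY; apply: h => //; apply: XY.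
    by exists X => //; have [h _ _] := FP _ FX; apply: h => //; apply: YX.
  - by move=> v [X FX Xv]; have [_ h _] := FP _ FX; apply: h.
  - by move=> v v' [X FX Xv]; have [_ _ h] := FP _ FX; apply: h.
have Gzero : G (0, 0).
  have [[[t v] Gtv]|/forallNP Gempty] := pselect (exists x, G x).
    have := Glin (-1) _ _ Gtv Gtv.
    by rewrite !scaleN1r !addNr.
  exfalso; apply: (Gmax (fun x => x = (0, 0))).
    split; first by move=> x /Gempty.
    by move=> /(_ (0, 0) erefl) /Gempty.
  split=> [c x y -> ->|v [] //|v v' [h ->]].
    by rewrite /= !scaler0 !addr0.
  by rewrite h (lin_zero lphi).
have Gtot t : exists v, G (t, v).
  apply: contrapT => Nt.
  (* If t is not in the domain, the only constraint on its value v0 is that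
     t1 + t = phi v2, with (t1, v1) in G, forces phi (v1 + v0) = phi v2; the
     constraints for different t1 agree because G satisfies its own. *)
  have [v0 hv0] : exists v0, forall t1 v1 v2, G (t1, v1) -> t1 + t = phi v2 ->
      phi (v1 + v0) = phi v2.
    have [[t1 [v1 [v2 [G1 e1]]]]|no] := pselect (exists t1 v1 v2,
        G (t1, v1) /\ t1 + t = phi v2); last first.
      by exists 0 => t1 v1 v2 G1 e1; case: no; exists t1, v1, v2.
    exists (v2 - v1) => t3 v3 v4 G3 e3.
    have : G (phi (v4 - v2), v3 - v1).
      have := Glin (-1) _ _ G1 G3; rewrite /= !scaleN1r ![- _ + _]addrC.
      have -> // : t3 - t1 = phi (v4 - v2).
      by rewrite (lin_sub lphi) -e3 -e1 opprD addrACA subrr addr0.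
    move/Gphi => e4; rewrite addrCA addrC (lin_add lphi) e4.
    by rewrite (lin_sub lphi) subrK.
  pose G' (x : T * V) := exists c y,
    G y /\ x = (c *: t + y.1, c *: v0 + y.2).
  apply: (Gmax G').
    split; first by move=> x Gx; exists 0, x; rewrite !scale0r !add0r; case: x Gx.
    move=> /(_ (t, v0)) h; apply: Nt; exists v0; apply: h.
    by exists 1, (0, 0); rewrite /= !scale1r !addr0.
  have lincomb c d (U : lmodType K) (u x y : U) :
    c *: (d *: u + x) + y = (c * d) *: u + (c *: x + y).
    by rewrite scalerDr scalerA addrA.
  split.
  - move=> c x y [d [x' [Gx ->]]] [e [y' [Gy ->]]].
    exists (c * d + e), (c *: x'.1 + y'.1, c *: x'.2 + y'.2).
    split; first exact: Glin.
    by rewrite /= !lincomb !scalerDl -!addrA; congr (_ + _, _ + _);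
      rewrite addrCA.
  - move=> v [c [y [Gy [e1 ->]]]].
    have [c0|c0] := eqVneq c 0.
      move: e1; rewrite c0 !scale0r !add0r => e1; apply: G0.
      by rewrite e1; case: y {e1} Gy.
    case: Nt; exists (- c^-1 *: y.2).
    have := Glin (- c^-1) _ _ Gy Gzero; rewrite /= !addr0.
    have -> // : - c^-1 *: y.1 = t.
    by move/esym/eqP: e1; rewrite addrC addr_eq0 => /eqP->;
      rewrite scaleNr scalerN opprK scalerA mulVf // scale1r.
  - move=> v v' [c [y [Gy [e1 ->]]]].
    have [c0|c0] := eqVneq c 0.
      move: e1; rewrite c0 !scale0r !add0r => e1; apply: Gphi.
      by rewrite e1; case: y {e1} Gy.
    have /hv0 := Glin c^-1 _ _ Gy Gzero; rewrite /= !addr0 => /(_ (c^-1 *: v)) h.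
    apply: (scalerI (invr_neq0 c0)).
    rewrite -!(lin_scale lphi) scalerDr scalerA mulVf //.
    rewrite scale1r addrC; apply: h.
    by rewrite (lin_scale lphi) e1 scalerDr scalerA mulVf // scale1r addrC.
have Guniq t v v' : G (t, v) -> G (t, v') -> v = v'.
  move=> h h'; have := Glin (-1) _ _ h' h; rewrite /= !scaleN1r addNr => /G0 /eqP.
  by rewrite addrC subr_eq0 => /eqP.
have /choice[s hs] := Gtot.
exists s => [c x y|v]; last exact: Gphi.
by apply: (Guniq (c *: x + y)) => //; exact: (Glin c (x, s x) (y, s y)).
Qed.

End GeneralizedInverse.

Section BalancedTensor.
Context {K : comNzRingType} {M N : lmodType K} {B : Type}.
Variables (ra : M -> B -> M) (la : B -> N -> N).
Local Notation T := (tens ra la).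

(** Pure tensors generate additively; being free of scalars, this induction also
    applies to antilinear maps. *)
Lemma tens_ind (P : T -> Prop) :
  P 0 -> (forall x y, P x -> P y -> P (x + y)) ->
  (forall m n, P (pure ra la m n)) -> forall x, P x.
Proof.
move=> P0 PD Pp x; rewrite [x]tens_pure.
by apply: big_ind => // p _; exact: Pp.
Qed.

Lemma eq_tlift (V : nmodType) (f g : M -> N -> V) (x : T) :
  (forall m n, f m n = g m n) -> tlift f x = tlift g x.
Proof. by move=> e; apply: eq_bigr. Qed.

(** By definition tlift f x is a finite sum over a fixed representative of x. *)
Lemma linear_tlift (V W : lmodType K) (h : V -> W) (f : M -> N -> V) (x : T) :
  linear h -> h (tlift f x) = tlift (fun m n => h (f m n)) x.
Proof. by move=> lh; rewrite /tlift (Defs.linear_sum _ _ lh). Qed.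

Lemma tlift_eta (V : lmodType K) (h : T -> V) (x : T) : linear h ->
  tlift (fun m n => h (pure ra la m n)) x = h x.
Proof. by move=> lh; rewrite -linear_tlift // -tens_pure. Qed.

Lemma eq_tens (V : lmodType K) (f g : T -> V) : linear f -> linear g ->
  (forall m n, f (pure ra la m n) = g (pure ra la m n)) -> f =1 g.
Proof.
by move=> lf lg e x; rewrite -(tlift_eta _ lf) -(tlift_eta _ lg); exact: eq_tlift.
Qed.

Lemma pure_linearl n : linear (fun m => pure ra la m n).
Proof. by have [h _ _] := pure_balanced ra la; exact: h. Qed.
Lemma pure_linearr m : linear (pure ra la m).
Proof. by have [_ h _] := pure_balanced ra la; exact: h. Qed.
Lemma pure_middle m b n : pure ra la (ra m b) n = pure ra la m (la b n).
Proof. by have [_ _ h] := pure_balanced ra la; exact: h. Qed.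

Lemma tlift_linear_param (U V : lmodType K) (f : U -> M -> N -> V) (x : T) :
  (forall m n, linear (fun u => f u m n)) -> linear (fun u => tlift (f u) x).
Proof.
move=> lf c u v; rewrite /tlift scaler_sumr -big_split.
by apply: eq_bigr => p _ /=; exact: lf.
Qed.

Lemma tlift_paramZ (V : lmodType K) c (f : M -> N -> V) (x : T) :
  tlift (fun m n => c *: f m n) x = c *: tlift f x.
Proof. by rewrite /tlift scaler_sumr. Qed.

End BalancedTensor.

Lemma exchange_tlift (K : comNzRingType) (M N M' N' : lmodType K) (B B' : Type)
    (ra : M -> B -> M) (la : B -> N -> N) (ra' : M' -> B' -> M')
    (la' : B' -> N' -> N') (V : nmodType) (f : M -> N -> M' -> N' -> V)
    (x : tens ra la) (y : tens ra' la') :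
  tlift (fun m n => tlift (f m n) y) x
  = tlift (fun m' n' => tlift (fun m n => f m n m' n') x) y.
Proof. exact: exchange_big. Qed.

Lemma bilinear_balanced (K : comNzRingType) (M N V : lmodType K)
    (f : M -> N -> V) :
  (forall n, linear (fun m => f m n)) -> (forall m, linear (f m)) ->
  balanced (@rscale K M) (@lscale K N) f.
Proof.
by move=> h1 h2; split=> // m c n;
  rewrite /rscale /lscale (lin_scale (h1 n)) (lin_scale (h2 m)).
Qed.


Section TensorMaps.
Variable K : comNzRingType.
Implicit Types M N V W : lmodType K.

Lemma tlift_tmap M N M' N' V (f : M -> M') (g : N -> N') (h : M' -> N' -> V) x :
  linear f -> linear g -> balanced (@rscale K M') (@lscale K N') h ->
  tlift h (tmap f g x) = tlift (fun m n => h (f m) (g n)) x.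
Proof.
move=> lf lg bh; rewrite /tmap linear_tlift; last exact: tlift_linear.
by apply: eq_tlift => m n; rewrite tlift_pure.
Qed.

Lemma eq_tmap M N M' N' (f f' : M -> M') (g g' : N -> N') x :
  f =1 f' -> g =1 g' -> tmap f g x = tmap f' g' x.
Proof. by move=> e e'; apply: eq_tlift => m n; rewrite e e'. Qed.

Lemma tmap_comp M N M' N' M'' N'' (f : M -> M') (g : N -> N')
    (f' : M' -> M'') (g' : N' -> N'') x :
  linear f -> linear g -> linear f' -> linear g' ->
  tmap f' g' (tmap f g x) = tmap (fun m => f' (f m)) (fun n => g' (g n)) x.
Proof. by move=> lf lg lf' lg'; rewrite [LHS]tlift_tmap //; exact: tmap_balanced. Qed.

Lemma tmap_subr M N M' N' (f : M -> M') (g h : N -> N') x :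
  tmap f (fun n => g n - h n) x = tmap f g x - tmap f h x.
Proof.
rewrite /tmap /tlift -sumrB; apply: eq_bigr => p _.
exact: lin_sub (pure_linearr _ _ _) _ _.
Qed.

Lemma tmap_id M N x : tmap (fun m : M => m) (fun n : N => n) x = x.
Proof. by rewrite [RHS]tens_pure. Qed.

End TensorMaps.

(** A linear left inverse of f stays a left inverse after tensoring. *)
Lemma tmap_inj (K : fieldType) (A V W : lmodType K) (f : W -> V) :
  linear f -> injective f -> injective (tmap (fun a : A => a) f).
Proof.
move=> lf fI; have [s ls fs] := generalized_inverse lf.
have sf w : s (f w) = w by apply: fI; rewrite fs.
have can_f : cancel (tmap (fun a : A => a) f) (tmap (fun a : A => a) s).
  by move=> x; rewrite tmap_comp // -[RHS]tmap_id; exact: eq_tmap.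
exact: can_inj can_f.
Qed.

(** * The coinvariant subalgebra and its coaction *)

Section LinearityRules.
Context {K : comNzRingType} {U : lmodType K}.

Lemma lin_pure_l (M N : lmodType K) B (ra : M -> B -> M) (la : B -> N -> N)
  (f : U -> M) n : linear f -> linear (fun x => pure ra la (f x) n).
Proof. exact: lin_comp (pure_linearl ra la n). Qed.
Lemma lin_pure_r (M N : lmodType K) B (ra : M -> B -> M) (la : B -> N -> N)
  (f : U -> N) m : linear f -> linear (fun x => pure ra la m (f x)).
Proof. exact: lin_comp (pure_linearr ra la m). Qed.
Lemma lin_tlift (M N V : lmodType K) B (ra : M -> B -> M) (la : B -> N -> N)
  (h : M -> N -> V) (f : U -> tens ra la) :
  balanced ra la h -> linear f -> linear (fun x => tlift h (f x)).
Proof. by move=> bh; apply: lin_comp; exact: tlift_linear. Qed.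
Lemma lin_tmap (M N M' N' : lmodType K) (g : M -> M') (h : N -> N')
  (f : U -> (M \ox N)%type) :
  linear g -> linear h -> linear f -> linear (fun x => tmap g h (f x)).
Proof. by move=> lg lh; apply: lin_comp; exact: tmap_linear. Qed.
Lemma lin_mul_l (A : algType K) (f : U -> A) a :
  linear f -> linear (fun x => f x * a).
Proof. by move=> lf c x y; rewrite lf mulrDl scalerAl. Qed.
Lemma lin_mul_r (A : algType K) (f : U -> A) a :
  linear f -> linear (fun x => a * f x).
Proof. by move=> lf c x y; rewrite lf mulrDr scalerAr. Qed.
Lemma lin_scaler (V : lmodType K) (f : U -> V) c :
  linear f -> linear (fun x => c *: f x).
Proof. by move=> lf d x y; rewrite lf scalerDr !scalerA mulrC. Qed.
Lemma lin_scalel (V : lmodType K) (f : U -> K^o) (v : V) :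
  linear f -> linear (fun x => f x *: v).
Proof. by move=> lf d x y; rewrite lf scalerDl scalerA. Qed.
Lemma lin_addf (V : lmodType K) (f g : U -> V) :
  linear f -> linear g -> linear (fun x => f x + g x).
Proof. by move=> lf lg c x y; rewrite lf lg scalerDr addrACA. Qed.
Lemma lin_oppf (V : lmodType K) (f : U -> V) :
  linear f -> linear (fun x => - f x).
Proof. by move=> lf c x y; rewrite lf opprD scalerN. Qed.
End LinearityRules.

(** Proves that a map is linear, or balanced over the base ring, by recursion on
    its expression.  The hook lin_atom is redefined below as further linear
    maps become available. *)
Ltac lin_atom := fail.
Ltac lin := cbv beta; lazymatch goal with
  | |- balanced (@rscale _ _) (@lscale _ _) _ =>
      apply: bilinear_balanced => [?|?]; lin
  | |- _ => first [ assumption | exact: lin_id | lin_atom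
      | apply: lin_pure_l; lin | apply: lin_pure_r; lin
      | apply: tlift_linear_param => ? ?; lin
      | apply: lin_tlift; lin
      | apply: lin_tmap; lin
      | apply: lin_mul_l; lin | apply: lin_mul_r; lin
      | apply: lin_scaler; lin | apply: lin_scalel; lin
      | apply: lin_addf; lin | apply: lin_oppf; lin
      | exact: linearP ] end.

Section Hopf.
Variables (R : realType).
Local Notation C := R[i].

Lemma corestrP (A : hopfStarAlg R) (V W : lmodType C) (incl : W -> V)
    (x : A \ox V) : (exists y, tmap idfun incl y = x) ->
  tmap idfun incl (corestr incl x) = x.
Proof. by move=> ex; exact: (xgetPex 0 ex). Qed.

Variables (A H : hopfStarAlg R) (pi : hopfStarMap A H).
Local Notation B := (qhs pi).

Lemma val_lin : linear (val : B -> A).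
Proof. exact: linearP. Qed.

Lemma coinvE (b : B) :
  tmap idfun pi (hdelta A (val b)) = val b \ox 1.
Proof. by have /asboolP := valP b. Qed.

Lemma mem_coinv (a : A) :
  tmap idfun pi (hdelta A a) = a \ox 1 -> a \in coinv pi.
Proof. by move=> ?; apply/asboolP. Qed.

Lemma delta_lin (D : hopfStarAlg R) : linear (hdelta D).
Proof. exact: linearP. Qed.
Lemma hmap_lin : linear pi.
Proof. exact: linearP. Qed.
Hint Resolve delta_lin hmap_lin val_lin : core.

Lemma lin_delta (D : hopfStarAlg R) (U : lmodType C) (f : U -> D) :
  linear f -> linear (fun x => hdelta D (f x)).
Proof. exact: (lin_comp (@delta_lin D)). Qed.
Lemma lin_hmap (U : lmodType C) (f : U -> A) :
  linear f -> linear (fun x => pi (f x)).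
Proof. exact: (lin_comp (@hmap_lin)). Qed.
Lemma lin_val (U : lmodType C) (f : U -> B) :
  linear f -> linear (fun x => val (f x)).
Proof. exact: (lin_comp (@val_lin)). Qed.
Ltac lin_atom ::= first [exact: delta_lin | exact: hmap_lin | exact: val_lin
  | apply: lin_delta; lin | apply: lin_hmap; lin | apply: lin_val; lin].

(** The form of coassociativity that composes with tmap. *)
Lemma hcoassocE (D : hopfStarAlg R) (a : D) :
  tmap idfun (hdelta D) (hdelta D a)
  = tlift (fun x y => tlift (fun x1 x2 => x1 \ox (x2 \ox y)) (hdelta D x))
      (hdelta D a).
Proof.
rewrite -hcoassoc; apply: eq_tlift => x y.
by rewrite (tlift_eta (h := pure _ _ _)) //; exact: pure_linearr.
Qed.

(** The comultiplication of b lands in A (x) B: by coassociativity its right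
    legs are killed by the map phi that cuts out B, and id - s phi, for a
    generalized inverse s of phi, projects A onto that kernel. *)
Lemma qdeltaP (b : B) : tmap idfun val (qdelta b) = hdelta A (val b).
Proof.
apply: corestrP.
pose phi (a : A) : A \ox H := tmap idfun pi (hdelta A a) - a \ox 1.
have lphi : linear phi by rewrite /phi; lin.
have [s ls sP] := generalized_inverse lphi.
(* b_(1) (x) b_(2) (x) pi(b_(3)) = b_(1) (x) b_(2) (x) 1, by applying
     Delta (x) id to the coinvariance of b *)
have phi0 : tmap idfun phi (hdelta A (val b)) = 0.
  have -> : tmap idfun phi (hdelta A (val b))
    = tmap idfun (tmap idfun pi) (tmap idfun (hdelta A) (hdelta A (val b)))
      - tmap idfun (fun a : A => a \ox (1 : H)) (hdelta A (val b)).
    rewrite tmap_comp; [|lin..].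
    exact: tmap_subr.
  pose k (x : A) (h : H) :=
    tlift (fun x1 x2 : A => x1 \ox (x2 \ox h)) (hdelta A x).
  have bk : balanced (@rscale C A) (@lscale C H) k by rewrite /k; lin.
  have -> : tmap idfun (tmap idfun pi) (tmap idfun (hdelta A) (hdelta A (val b)))
      = tlift k (tmap idfun pi (hdelta A (val b))).
    rewrite hcoassocE linear_tlift; last lin.
    rewrite [RHS]tlift_tmap; [|lin..].
    apply: eq_tlift => x y; rewrite linear_tlift; last lin.
    by apply: eq_tlift => x1 x2; rewrite !tmap_pure //; lin.
  rewrite coinvE tlift_pure // /k.
  by rewrite /tmap subrr.
have mem a : a - s (phi a) \in coinv pi.
  apply: mem_coinv; apply/eqP; rewrite -subr_eq0; apply/eqP.
  by rewrite -/(phi _) (lin_sub lphi) sP subrr.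
pose r a : B := exist (fun x => x \in coinv pi) _ (mem a).
have lr : linear r.
  move=> c x y; apply: val_inj => /=.
  have : linear (fun a => a - s (phi a)).
    by apply: lin_addf; [|apply: lin_oppf; apply: lin_comp]; lin.
  exact.
exists (tmap idfun r (hdelta A (val b))).
rewrite tmap_comp; [|lin..]; rewrite /=.
rewrite tmap_subr tmap_id.
rewrite -[X in _ - X](tmap_comp (f' := idfun) (g' := s) _ (@lin_id _ _) lphi) //.
by rewrite phi0 (lin_zero (tmap_linear _ _)) ?subr0.
Qed.

Lemma qdelta_eq (b : B) t : tmap idfun val t = hdelta A (val b) -> qdelta b = t.
Proof.
by move=> e; apply: (tmap_inj val_lin val_inj); rewrite qdeltaP.
Qed.

Lemma qdelta_lin : linear (qdelta (pi := pi)).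
Proof.
move=> c x y; apply: qdelta_eq.
by rewrite (tmap_linear _ val_lin) // !qdeltaP -delta_lin.
Qed.

Lemma qdelta1 : qdelta (1 : B) = 1 \ox 1.
Proof. by apply: qdelta_eq; rewrite tmap_pure //= ?hdelta1 //; exact: val_lin. Qed.

Lemma hanti_lin (D : hopfStarAlg R) : linear (hanti D).
Proof. exact: linearP. Qed.
Lemma lin_anti (D : hopfStarAlg R) (U : lmodType C) (f : U -> D) :
  linear f -> linear (fun x => hanti D (f x)).
Proof. exact: (lin_comp (@hanti_lin D)). Qed.
Lemma eps_lin (D : hopfStarAlg R) : linear (heps D : D -> C^o).
Proof. by move=> c x y; rewrite linearP. Qed.
Lemma lin_eps (D : hopfStarAlg R) (U : lmodType C) (f : U -> D) :
  linear f -> linear (fun x => heps D (f x) : C^o).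
Proof. exact: (lin_comp (@eps_lin D)). Qed.
Lemma lin_qdelta (U : lmodType C) (f : U -> B) :
  linear f -> linear (fun x => qdelta (f x)).
Proof. exact: (lin_comp qdelta_lin). Qed.
Ltac lin_atom ::= first [exact: delta_lin | exact: hmap_lin | exact: val_lin
  | exact: hanti_lin | exact: eps_lin | exact: qdelta_lin
  | apply: lin_delta; lin | apply: lin_hmap; lin | apply: lin_val; lin
  | apply: lin_anti; lin | apply: lin_eps; lin | apply: lin_qdelta; lin].

(** The identity that makes a (x) [m] |-> a S(m_(-1)) (x) m_(0) well defined. *)
Lemma anti_qdelta (b : B) :
  tlift (fun a b' => hanti A a * val b') (qdelta b) = (heps A (val b))%:A.
Proof. by rewrite -hantil -qdeltaP tlift_tmap //; lin. Qed.

End Hopf.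

Ltac lin_hopf := first [exact: delta_lin | exact: hmap_lin | exact: val_lin
  | exact: hanti_lin | exact: eps_lin | exact: qdelta_lin
  | apply: lin_delta; lin | apply: lin_hmap; lin | apply: lin_val; lin
  | apply: lin_anti; lin | apply: lin_eps; lin | apply: lin_qdelta; lin].
Ltac lin_atom ::= lin_hopf.

(** * The antipode is antimultiplicative *)

Section Antipode.
Variables (R : realType) (D : hopfStarAlg R).
Local Notation C := R[i].

(** Coassociativity under an arbitrary trilinear expression: this is what allows
    a Sweedler index to be renumbered. *)
Lemma coassoc_tlift (V : lmodType C) (F : D -> D -> D -> V) (a : D) :
  (forall y z, linear (fun x => F x y z)) ->
  (forall x z, linear (fun y => F x y z)) ->
  (forall x y, linear (F x y)) ->
  tlift (fun x y => tlift (F x) (hdelta D y)) (hdelta D a)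
  = tlift (fun x y => tlift (fun x1 x2 => F x1 x2 y) (hdelta D x)) (hdelta D a).
Proof.
move=> l1 l2 l3.
have bF x : balanced (@rscale C D) (@lscale C D) (F x).
  by apply: bilinear_balanced => ?; [exact: l2 | exact: l3].
pose G (x : D) (z : D \ox D) : V := tlift (F x) z.
have bG : balanced (@rscale C D) (@lscale C (D \ox D)%type) G.
  apply: bilinear_balanced => ?.
    by apply: tlift_linear_param => ? ?; exact: l1.
  exact: tlift_linear.
have lG := tlift_linear bG.
have GE (z : D \ox D) (f : D -> D -> (D \ox (D \ox D)%type)%type) :
  tlift G (tlift f z) = tlift (fun p q => tlift G (f p q)) z.
  by rewrite (linear_tlift _ _ lG).
transitivity (tlift G (tlift (fun x y =>
    tlift (fun y1 y2 => x \ox (y1 \ox y2)) (hdelta D y)) (hdelta D a))).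
  rewrite GE //; apply: eq_tlift => x y; rewrite GE //.
  by apply: eq_tlift => y1 y2; rewrite tlift_pure // /G tlift_pure.
rewrite hcoassoc GE //; apply: eq_tlift => x y; rewrite GE //.
by apply: eq_tlift => x1 x2; rewrite tlift_pure // /G tlift_pure.
Qed.

Local Notation S := (hanti D).

(** S(x_(1) y_(1)) x_(2) y_(2) S(y_(3)) S(x_(3)) collapses to S(xy) from the right
    and to S(y) S(x) from the left. *)
Lemma hantiM (x y : D) : hanti D (x * y) = hanti D y * hanti D x.
Proof.
pose F x1 x2 x3 y1 y2 y3 : D := S (x1 * y1) * (x2 * (y2 * S y3) * S x3).
(* the grouping x_(1), (x_(2), x_(3)) and y_(1), (y_(2), y_(3)) *)
transitivity (tlift (fun x1 x' => tlift (fun x2 x3 => tlift (fun y1 y' =>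
    tlift (F x1 x2 x3 y1) (hdelta D y')) (hdelta D y)) (hdelta D x')) (hdelta D x)).
  have -> : S (x * y) = tlift (fun x1 x' => tlift (fun y1 y' =>
      (heps D x' * heps D y') *: S (x1 * y1)) (hdelta D y)) (hdelta D x).
    rewrite -{1}[x]hcounitr (linear_tlift (h := fun z => S (z * y))); last lin.
    apply: eq_tlift => x1 x'.
    rewrite -{1}[y]hcounitr (linear_tlift (h := fun z => S (_ * z))); last lin.
    apply: eq_tlift => y1 y'.
    by rewrite -scalerAr -scalerAl scalerA !(lin_scale (@hanti_lin _ D)) mulrC.
  apply: eq_tlift => x1 x'; rewrite exchange_tlift; apply: eq_tlift => y1 y'.
  transitivity (tlift (fun x2 x3 => S (x1 * y1) *
      (x2 * tlift (fun y2 y3 => y2 * S y3) (hdelta D y') * S x3)) (hdelta D x')).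
    rewrite hantir.
    rewrite (eq_tlift _ (g := fun x2 x3 =>
        heps D y' *: (S (x1 * y1) * (x2 * S x3)))); last first.
      by move=> x2 x3; rewrite -scalerAr mulr1 -scalerAl -scalerAr.
    rewrite tlift_paramZ -(linear_tlift (h := fun z => _ * z)); last lin.
    by rewrite hantir -scalerAr mulr1 scalerA mulrC.
  apply: eq_tlift => x2 x3.
  by rewrite (linear_tlift (h := fun z => S (x1 * y1) * (x2 * z * S x3))); last lin.
(* regrouping as (x_(1), x_(2)), x_(3) and (y_(1), y_(2)), y_(3) *)
rewrite (coassoc_tlift (F := fun x1 x2 x3 => tlift (fun y1 y' =>
    tlift (F x1 x2 x3 y1) (hdelta D y')) (hdelta D y))); last first.
- by move=> x1 x2; rewrite /F; lin.
- by move=> x1 x3; rewrite /F; lin.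
- by move=> x2 x3; rewrite /F; lin.
rewrite (eq_tlift _ (g := fun x' x3 => tlift (fun y' y3 =>
    (heps D x' * heps D y') *: (S y3 * S x3)) (hdelta D y))); last first.
  move=> x' x3.
  rewrite (eq_tlift _ (g := fun x1 x2 => tlift (fun y' y3 =>
     tlift (fun y1 y2 => F x1 x2 x3 y1 y2 y3) (hdelta D y')) (hdelta D y))); last first.
    move=> x1 x2; rewrite (coassoc_tlift (F := F x1 x2 x3)) //.
    + by move=> y1 y2; rewrite /F; lin.
    + by move=> y1 y3; rewrite /F; lin.
    + by move=> y2 y3; rewrite /F; lin.
  rewrite exchange_tlift; apply: eq_tlift => y' y3.
  have -> : (heps D x' * heps D y') *: (S y3 * S x3) =
     (heps D (x' * y'))%:A * (S y3 * S x3).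
    by rewrite rmorphM mulr_algl.
  rewrite -hantil hdeltaM.
  have bS : balanced (@rscale C D) (@lscale C D) (fun a b => hanti D a * b) by lin.
  rewrite /tmul (linear_tlift _ _ (tlift_linear bS)).
  rewrite (linear_tlift (h := fun z => z * _)); last lin.
  apply: eq_tlift => x1 x2.
  rewrite (linear_tlift _ _ (tlift_linear bS)).
  rewrite (linear_tlift (h := fun z => z * _)); last lin.
  by apply: eq_tlift => y1 y2; rewrite tlift_pure // /F !mulrA.
rewrite exchange_tlift -{2}[x]hcounitl -{2}[y]hcounitl.
rewrite (linear_tlift (h := fun z => S z * _)); last lin.
apply: eq_tlift => y' y3; rewrite (linear_tlift (h := fun z => _ * S z)); last lin.
apply: eq_tlift => x' x3.
by rewrite !(lin_scale (@hanti_lin _ D)) -scalerAr -scalerAl scalerA.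
Qed.

End Antipode.

(** * Faithfulness of the fibre functor *)

Section Spans.
Variables (K : comNzRingType) (V W : lmodType K).

Lemma mem_spanned (P : V -> Prop) x : P x -> x \in spanned P.
Proof.
move=> Px; apply/asboolP; exists [:: (1, x)]; split.
  by move=> p; rewrite inE => /eqP->.
by rewrite big_seq1 scale1r.
Qed.

Lemma spanned_sub (P : V -> Prop) (U : submodClosed W) (f : V -> W) : linear f ->
  (forall x, P x -> f x \in U) -> forall x, x \in spanned P -> f x \in U.
Proof.
move=> lf fP x /asboolP[s [Ps ->]]; rewrite (Defs.linear_sum _ _ lf).
rewrite big_seq; apply: rpred_sum => p ps; rewrite (lin_scale lf).
by apply: rpredZ; apply/fP/Ps.
Qed.

Lemma spanned_ker (P : V -> Prop) (f : V -> W) : linear f ->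
  (forall x, P x -> f x = 0) -> forall x, x \in spanned P -> f x = 0.
Proof.
move=> lf fP x /asboolP[s [Ps ->]]; rewrite (Defs.linear_sum _ _ lf).
by rewrite big_seq big1 // => p ps; rewrite (lin_scale lf) fP ?scaler0 //; exact: Ps.
Qed.

End Spans.

Section Bimodules.
Variables (R : realType) (A H : hopfStarAlg R) (pi : hopfStarMap A H).
Local Notation C := R[i].
Local Notation B := (qhs pi).
Implicit Types (M N : covBimod pi).

Section ModuleLaws.
Variables (M : covBimod pi) (cM : covariant_bimodule M).

Lemma lin_bl (U : lmodType C) (f : U -> M) b :
  linear f -> linear (fun x => bl b (f x)).
Proof. by case: cM => [[h _ _ _] _ _ _ _]; exact: (lin_comp (h b)). Qed.
Lemma lin_bl_arg (U : lmodType C) (f : U -> B) (m : M) :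
  linear f -> linear (fun x => bl (f x) m).
Proof. by case: cM => [[_ h _ _] _ _ _ _]; exact: (lin_comp (h m)). Qed.
Lemma lin_br (U : lmodType C) (f : U -> M) b :
  linear f -> linear (fun x => br (f x) b).
Proof. by case: cM => [_ [h _ _ _] _ _ _]; exact: (lin_comp (h b)). Qed.
Lemma lin_br_arg (U : lmodType C) (f : U -> B) (m : M) :
  linear f -> linear (fun x => br m (f x)).
Proof. by case: cM => [_ [_ h _ _] _ _ _]; exact: (lin_comp (h m)). Qed.
Lemma bco_lin : linear (@bco _ _ _ _ M).
Proof. by case: cM => [_ _ _ [h _ _] _]. Qed.
Lemma lin_bco (U : lmodType C) (f : U -> M) :
  linear f -> linear (fun x => bco (f x)).
Proof. exact: (lin_comp bco_lin). Qed.

Lemma bl1 (m : M) : bl 1 m = m.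
Proof. by case: cM => [[]]. Qed.
Lemma br1 (m : M) : br m 1 = m.
Proof. by case: cM => [_ []]. Qed.
Lemma blA a b (m : M) : bl (a * b) m = bl a (bl b m).
Proof. by case: cM => [[]]. Qed.
Lemma brA a b (m : M) : br m (a * b) = br (br m a) b.
Proof. by case: cM => [_ []]. Qed.
Lemma bl_br b c (m : M) : bl b (br m c) = br (bl b m) c.
Proof. by case: cM. Qed.

Lemma bco_coassoc (m : M) :
  tlift (fun a w => tlift (fun a' w' => a \ox (a' \ox w')) (bco w)) (bco m)
  = tlift (fun a w => tlift (fun a1 a2 => a1 \ox (a2 \ox w)) (hdelta A a)) (bco m).
Proof. by case: cM => [_ _ _ [_ h _] _]. Qed.
Lemma bco_counit (m : M) : tlift (fun a w => heps A a *: w) (bco m) = m.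
Proof. by case: cM => [_ _ _ [_ _ h] _]. Qed.

End ModuleLaws.

End Bimodules.

Ltac lin_bimod := first
  [ (apply: lin_bl; [assumption|lin]) | (apply: lin_bl_arg; [assumption|lin])
  | (apply: lin_br; [assumption|lin]) | (apply: lin_br_arg; [assumption|lin])
  | (apply: lin_bco; [assumption|lin]) ].
Ltac lin_atom ::= first [lin_hopf | lin_bimod].

Section Takeuchi.
Variables (R : realType) (A H : hopfStarAlg R) (pi : hopfStarMap A H).
Local Notation C := R[i].
Local Notation B := (qhs pi).
Variables (M : covBimod pi) (cM : covariant_bimodule M).

Lemma bco_bl b (m : M) : bco (bl b m) =
  tlift (fun b1 b2 => tlift (fun m1 m0 => (b1 * m1) \ox bl b2 m0) (bco m)) (qdelta b).
Proof.
have [_ _ _ _ h] := cM; rewrite -{1}[m](br1 cM) h.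
do 2!apply: eq_tlift => ? ?; rewrite qdelta1 tlift_pure; last lin.
by rewrite mulr1 (br1 cM).
Qed.

Lemma bco_br b (m : M) : bco (br m b) =
  tlift (fun m1 m0 => tlift (fun b1 b2 => (m1 * b1) \ox br m0 b2) (qdelta b)) (bco m).
Proof.
have [_ _ _ _ h] := cM; rewrite -{1}[br m b](bl1 cM) h.
rewrite qdelta1 tlift_pure; last lin.
by do 2!apply: eq_tlift => ? ?; rewrite mul1r (bl1 cM).
Qed.

Lemma bco_coassoc_tlift (V : lmodType C) (F : A -> A -> M -> V) (m : M) :
  (forall y w, linear (fun x => F x y w)) ->
  (forall x w, linear (fun y => F x y w)) ->
  (forall x y, linear (F x y)) ->
  tlift (fun a w => tlift (F a) (bco w)) (bco m)
  = tlift (fun a w => tlift (fun a1 a2 => F a1 a2 w) (hdelta A a)) (bco m).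
Proof.
move=> l1 l2 l3.
pose G (x : A) (z : A \ox M) : V := tlift (F x) z.
have bF x : balanced (@rscale C A) (@lscale C M) (F x).
  by apply: bilinear_balanced => ?; [exact: l2 | exact: l3].
have lG : linear (tlift G : A \ox (A \ox M)%type -> V).
  apply: tlift_linear; apply: bilinear_balanced => ?.
    by apply: tlift_linear_param => ? ?; exact: l1.
  exact: tlift_linear.
have GE x y w : tlift G (x \ox (y \ox w)) = F x y w.
  rewrite tlift_pure /G ?tlift_pure //; apply: bilinear_balanced => ?.
    by apply: tlift_linear_param => ? ?; exact: l1.
  exact: tlift_linear.
have /(congr1 (tlift G)) := bco_coassoc cM m.
rewrite ![in X in X -> _](linear_tlift _ _ lG) => e.
transitivity (tlift (fun a w =>
    tlift G (tlift (fun a' w' => a \ox (a' \ox w')) (bco w))) (bco m)).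
  apply: eq_tlift => a w; rewrite (linear_tlift _ _ lG).
  by apply: eq_tlift => a' w'; rewrite GE.
rewrite e; apply: eq_tlift => a w; rewrite (linear_tlift _ _ lG).
by apply: eq_tlift => a1 a2; rewrite GE.
Qed.

Lemma cls_lin : linear (@cls _ _ _ _ M).
Proof. by move=> c x y; rewrite /cls vquotD -vquot_scaleE. Qed.

Lemma cls_eq (x y : M) : cls x = cls y <-> x - y \in augl M.
Proof. exact: vquot_eq. Qed.

Lemma repK (u : Phi M) : cls (rep u) = u.
Proof. exact: reprK. Qed.

(** Because b - eps(b) lies in B^+. *)
Lemma cls_bl b (m : M) : cls (bl b m) = heps A (val b) *: cls m.
Proof.
rewrite -(lin_scale cls_lin); apply/cls_eq.
have -> : bl b m - heps A (val b) *: m = bl (b - (heps A (val b))%:A) m.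
  have lb : linear (fun b => bl b m) by lin.
  by rewrite (lin_sub lb) (lin_scale lb) (bl1 cM).
apply: mem_spanned; exists (b - (heps A (val b))%:A), m; split=> //.
have le : linear (fun b : B => heps A (val b) : C^o) by lin.
by rewrite (lin_sub le) (lin_scale le) /= rmorph1 [_ *: _]mulr1 subrr.
Qed.

(** A linear map that kills B^+ M may be evaluated on chosen representatives of
    the classes: this is how the maps induced on fibres are computed. *)
Lemma rep_factor (V : lmodType C) (f : M -> V) : linear f ->
  (forall b m, heps A (val b) = 0 -> f (bl b m) = 0) ->
  linear (fun u => f (rep u)) /\ forall m, f (rep (cls m)) = f m.
Proof.
move=> lf f0.
have fc m : f (rep (cls m)) = f m.
  apply/eqP; rewrite -subr_eq0 -(lin_sub lf); apply/eqP.
  apply: (spanned_ker lf (P := fun x => exists b m, heps A (val b) = 0 /\ x = bl b m)).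
    by move=> x [b [m' [e ->]]]; exact: f0.
  by apply/cls_eq; rewrite repK.
split=> // c u v; rewrite -{1}[u]repK -{1}[v]repK -cls_lin fc lf //.
Qed.

Hypothesis A_flat : faithfully_flat_right (fun (a : A) (b : B) => a * val b).
Let ra (a : A) (b : B) : A := a * val b.
Local Notation AM := (tens ra (@bl _ _ _ _ M)).

Let amul (a : A) : AM -> AM := tlift (fun a' m => pure ra (@bl _ _ _ _ M) (a * a') m).
Let amul_bal a : balanced ra (@bl _ _ _ _ M)
  (fun a' m => pure ra (@bl _ _ _ _ M) (a * a') m).
Proof.
split=> [?|?|a' b m]; [lin|lin|].
by rewrite /ra mulrA -pure_middle.
Qed.

(** If 1 (x) m = 0 then b |-> b m becomes zero after applying A (x)_B -, so by
    faithful flatness it was already zero. *)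
Lemma one_pure_eq0 (m : M) : pure ra (@bl _ _ _ _ M) 1 m = 0 -> m = 0.
Proof.
move=> m0; have [lM _ _ _ _] := cM.
have lf : linear (fun b => bl b m) by lin.
pose f := HB.pack_for {linear B -> M} (fun b => bl b m)
  (GRing.isLinear.Build _ _ _ _ _ lf).
have lB : left_module (fun b c : B => b * c).
  split; [by move=> b; lin | by move=> b; lin | exact: mul1r |].
  by move=> a b c; rewrite mulrA.
have [_ ex] := @A_flat _ _ _ _ _ _ f (idfun : {linear M -> M})
  lB lM lM (fun b x => blA cM b x m) (fun b x => erefl).
have f0 (x : tens ra (fun b c : B => b * c)) :
    tlift (fun p b => pure ra (@bl _ _ _ _ M) p (f b)) x = 0 :> AM.
  have lp : linear (amul 1) by exact: tlift_linear.
  rewrite /tlift big1 // => -[p b] _ /=; rewrite -pure_middle.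
  rewrite -[ra p b]mulr1 -(@tlift_pure _ _ _ _ _ _ _ _ 1 m (amul_bal (ra p b))).
  by rewrite m0 (lin_zero (tlift_linear (amul_bal _))).
suff /ex/(_ m)[_ h] : exact_at
    (tlift (fun p b => pure ra (@bl _ _ _ _ M) p (f b)) :
       tens ra (fun b c : B => b * c) -> AM)
    (tlift (fun p x => pure ra (@bl _ _ _ _ M) p x)).
  by apply: h; exists 1; exact: (bl1 cM).
move=> y; rewrite -[tlift _ y]tens_pure; split=> [->|[x <-]]; last exact: f0.
by exists 0; exact: f0.
Qed.

(* t is the restriction to 1 (x) M of the inverse of the isomorphism
   A (x)_B M -> A (x) M/(B^+ M), a (x) m |-> a m_(-1) (x) [m_(0)] *)
Let t (m : M) : AM :=
  tlift (fun a m0 => pure ra (@bl _ _ _ _ M) (hanti A a) m0) (bco m).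

Let t_bal : balanced (@rscale C A) (@lscale C M)
  (fun a m0 => pure ra (@bl _ _ _ _ M) (hanti A a) m0).
Proof. lin. Qed.

Let t_lin : linear t.
Proof. by rewrite /t; lin. Qed.

Let t_aug b (m : M) : heps A (val b) = 0 -> t (bl b m) = 0.
Proof.
move=> b0; rewrite /t bco_bl exchange_tlift (linear_tlift _ _ (tlift_linear t_bal)).
transitivity (tlift (fun m1 m0 => pure ra (@bl _ _ _ _ M)
   (hanti A m1 * tlift (fun b1 b2 => hanti A b1 * val b2) (qdelta b)) m0) (bco m)).
  apply: eq_tlift => m1 m0; rewrite (linear_tlift _ _ (tlift_linear t_bal)).
  rewrite (linear_tlift (h := fun z => pure _ _ (_ * z) _)); last lin.
  apply: eq_tlift => b1 b2; rewrite tlift_pure //.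
  by rewrite -pure_middle /ra hantiM mulrA.
rewrite anti_qdelta b0 scale0r /tlift big1 // => p _.
by rewrite mulr0; exact: lin_zero (pure_linearl _ _ _).
Qed.

(** Applying a (x) [m] |-> a S(m_(-1)) (x) m_(0) to m_(-1) (x) [m_(0)] gives
    m_(-2) S(m_(-1)) (x) m_(0) = 1 (x) m. *)
Lemma coaction_cls_inj (m : M) : tmap idfun (@cls _ _ _ _ M) (bco m) = 0 -> m = 0.
Proof.
move=> m0; apply: one_pure_eq0.
have [lt' tE] := rep_factor t_lin t_aug.
pose T (a : A) (u : Phi M) : AM := amul a (t (rep u)).
have bT : balanced (@rscale C A) (@lscale C (Phi M)) T.
  apply: bilinear_balanced => [u|a]; rewrite /T.
    by apply: tlift_linear_param => ? ?; lin.
  exact: (lin_comp (tlift_linear (amul_bal a))).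
have := congr1 (tlift T) m0.
rewrite (lin_zero (tlift_linear bT)) tlift_tmap //; last exact: cls_lin.
move=> <-; transitivity (tlift (fun a w => tlift (fun a' w' =>
    pure ra (@bl _ _ _ _ M) (a * hanti A a') w') (bco w)) (bco m)); last first.
  apply: eq_tlift => a w; rewrite /T tE /amul /t.
  rewrite (linear_tlift _ _ (tlift_linear (amul_bal a))).
  by apply: eq_tlift => a' w'; rewrite tlift_pure //; exact: amul_bal.
rewrite bco_coassoc_tlift; [|by move=> ? ?; lin..].
transitivity (tlift (fun a w => pure ra (@bl _ _ _ _ M) 1 (heps A a *: w)) (bco m)).
  rewrite -{1}[m](bco_counit cM) (linear_tlift (h := pure _ _ 1)) //.
  exact: pure_linearr.
apply: eq_tlift => a w.
rewrite -(linear_tlift (h := fun z => pure _ _ z w)); last exact: pure_linearl.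
rewrite hantir (lin_scale (pure_linearl _ _ _)) (lin_scale (pure_linearr _ _ _)) //.
Qed.

(** The difference f m - m has m_(-1) (x) [f m_(0) - m_(0)] = 0 as its image in
    A (x) M/(B^+ M). *)
Lemma colinear_id (f : M -> M) :
  (forall m, bco (f m) = tmap idfun f (bco m)) -> linear f ->
  (forall m, cls (f m) = cls m) -> forall m, f m = m.
Proof.
move=> fco lf fcls m; apply/eqP; rewrite -subr_eq0; apply/eqP.
apply: coaction_cls_inj; rewrite (lin_sub (bco_lin cM)) fco.
rewrite (lin_sub (tmap_linear _ cls_lin)) // tmap_comp //; last exact: cls_lin.
by rewrite (eq_tmap (f' := idfun) (g' := @cls _ _ _ _ M)) ?subrr.
Qed.

End Takeuchi.

(** * Morphisms and tensor products of covariant bimodules *)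

Section Morphisms.
Variables (R : realType) (A H : hopfStarAlg R) (pi : hopfStarMap A H).
Local Notation C := R[i].
Local Notation B := (qhs pi).
Implicit Types (L M N : covBimod pi).

Lemma cov_morphism_comp L M N (f : L -> M) (g : M -> N) :
  cov_morphism f -> cov_morphism g -> cov_morphism (fun x => g (f x)).
Proof.
move=> [lf fl fr fco] [lg gl gr gco]; split.
- exact: (lin_comp lg lf).
- by move=> b m; rewrite fl gl.
- by move=> b m; rewrite fr gr.
- by move=> m; rewrite gco fco tmap_comp.
Qed.

(** The part of the laws of a covariant bimodule that makes its morphisms closed
    under linear combinations. *)
Definition linear_structure N : Prop :=
  [/\ forall b, linear (@bl _ _ _ _ N b), forall b, linear (fun x => @br _ _ _ _ N x b)
    & linear (@bco _ _ _ _ N)].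

Lemma cov_morphism_subZ M N (f g : M -> N) c : linear_structure N ->
  cov_morphism f -> cov_morphism g -> cov_morphism (fun x => f x - c *: g x).
Proof.
move=> [ll lr lc] [lf fl fr fco] [lg gl gr gco]; split.
- by apply: lin_addf => //; apply: lin_oppf; exact: lin_scaler.
- by move=> b m; rewrite fl gl (lin_sub (ll b)) (lin_scale (ll b)).
- by move=> b m; rewrite fr gr (lin_sub (lr b)) (lin_scale (lr b)).
- move=> m; rewrite (lin_sub lc) (lin_scale lc) fco gco tmap_subr; congr (_ - _).
  rewrite (linear_tlift (h := fun z => c *: z)); last by apply: lin_scaler.
  by apply: eq_tlift => a x; rewrite (lin_scale (pure_linearr _ _ _)).
Qed.

Lemma covariant_linear M : covariant_bimodule M -> linear_structure M.
Proof. by move=> cM; split=> [b|b|]; lin. Qed.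

Lemma unit_linear : linear_structure (cov_unit pi).
Proof.
split=> [b|b|]; last exact: qdelta_lin.
  by apply: lin_mul_r; lin.
by apply: lin_mul_l; lin.
Qed.

Lemma lin_pureB_l (U : lmodType C) M N (f : U -> M) (n : N) :
  linear f -> linear (fun x => pureB (f x) n).
Proof. exact: lin_pure_l. Qed.
Lemma lin_pureB_r (U : lmodType C) M N (f : U -> N) (m : M) :
  linear f -> linear (fun x => pureB m (f x)).
Proof. exact: lin_pure_r. Qed.
Lemma pureB_middle M N (m : M) b (n : N) : pureB (br m b) n = pureB m (bl b n).
Proof. exact: pure_middle. Qed.

End Morphisms.

Ltac lin_pureB := first [(apply: lin_pureB_l; lin) | (apply: lin_pureB_r; lin)].
Ltac lin_atom ::= first [lin_hopf | lin_bimod | lin_pureB].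

Section TensorProduct.
Variables (R : realType) (A H : hopfStarAlg R) (pi : hopfStarMap A H).
Local Notation C := R[i].
Local Notation B := (qhs pi).

Section Structure.
Variables (M N : covBimod pi).
Hypotheses (cM : covariant_bimodule M) (cN : covariant_bimodule N).

Let bl_bal b : balanced (@br _ _ _ _ M) (@bl _ _ _ _ N) (fun m n => pureB (bl b m) n).
Proof.
split=> [?|?|m c n]; [lin|lin|].
by rewrite (bl_br cM) pureB_middle.
Qed.

Let br_bal b : balanced (@br _ _ _ _ M) (@bl _ _ _ _ N) (fun m n => pureB m (br n b)).
Proof.
split=> [?|?|m c n]; [lin|lin|].
by rewrite -(bl_br cN) pureB_middle.
Qed.

Let bco_bal : balanced (@br _ _ _ _ M) (@bl _ _ _ _ N) (fun m n =>
  tlift (fun m1 m0 => tlift (fun n1 n0 => (m1 * n1) \ox pureB m0 n0) (bco n)) (bco m)).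
Proof.
split=> [?|?|m b n]; [lin|lin|].
rewrite (bco_br cM) linear_tlift; last by apply: tlift_linear; lin.
apply: eq_tlift => m1 m0; rewrite linear_tlift; last by apply: tlift_linear; lin.
rewrite (bco_bl cN) linear_tlift; last by apply: tlift_linear; lin.
apply: eq_tlift => b1 b2; rewrite linear_tlift; last by apply: tlift_linear; lin.
rewrite tlift_pure; last lin.
apply: eq_tlift => n1 n0; rewrite tlift_pure; last lin.
by rewrite mulrA pureB_middle.
Qed.

Lemma bl_pureB b (m : M) (n : N) : bl b (pureB m n) = pureB (bl b m) n.
Proof. exact: tlift_pure (bl_bal b). Qed.
Lemma br_pureB b (m : M) (n : N) : br (pureB m n) b = pureB m (br n b).
Proof. exact: tlift_pure (br_bal b). Qed.
Lemma bco_pureB (m : M) (n : N) : bco (pureB m n) =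
  tlift (fun m1 m0 => tlift (fun n1 n0 => (m1 * n1) \ox pureB m0 n0) (bco n)) (bco m).
Proof. exact: tlift_pure bco_bal. Qed.

Lemma tens_linear : linear_structure (cov_tens M N).
Proof.
split=> [b|b|].
- exact: tlift_linear (bl_bal b).
- exact: tlift_linear (br_bal b).
- exact: tlift_linear bco_bal.
Qed.

Lemma pureB_ind (P : cov_tens M N -> Prop) : P 0 ->
  (forall x y, P x -> P y -> P (x + y)) -> (forall m n, P (pureB m n)) ->
  forall x, P x.
Proof. exact: tens_ind. Qed.

End Structure.

Variables (M M' N N' : covBimod pi).
Hypotheses (cM : covariant_bimodule M) (cN : covariant_bimodule N).
Hypotheses (cM' : covariant_bimodule M') (cN' : covariant_bimodule N').
Variables (f : M -> M') (g : N -> N').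
Hypotheses (mf : cov_morphism f) (mg : cov_morphism g).

Lemma tmapB_balanced : balanced (@br _ _ _ _ M) (@bl _ _ _ _ N)
  (fun m n => pureB (f m) (g n)).
Proof.
have [lf _ fr _] := mf; have [lg gl _ _] := mg.
split=> [?|?|m b n]; [lin|lin|].
by rewrite fr gl pureB_middle.
Qed.

Lemma tmapB_pure m n : tmapB f g (pureB m n) = pureB (f m) (g n).
Proof. exact: tlift_pure tmapB_balanced. Qed.

Lemma tlift_tmapB (V : lmodType C) (h : M' -> N' -> V) x :
  balanced (@br _ _ _ _ M') (@bl _ _ _ _ N') h ->
  tlift h (tmapB f g x) = tlift (fun m n => h (f m) (g n)) x.
Proof.
move=> bh; rewrite /tmapB linear_tlift; last exact: tlift_linear.
by apply: eq_tlift => m n; exact: tlift_pure.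
Qed.

Lemma tmapB_morphism : cov_morphism (tmapB f g).
Proof.
have [lf fl fr fco] := mf; have [lg gl gr gco] := mg.
have lfg : linear (tmapB f g) := tlift_linear tmapB_balanced.
have [ll lr lc] := tens_linear cM cN; have [ll' lr' lc'] := tens_linear cM' cN'.
split=> //.
- move=> b; apply: (eq_tens (lin_comp lfg (ll b)) (lin_comp (ll' b) lfg)) => m n.
  by rewrite -/(pureB m n) bl_pureB // !tmapB_pure bl_pureB // fl.
- move=> b; apply: (eq_tens (lin_comp lfg (lr b)) (lin_comp (lr' b) lfg)) => m n.
  by rewrite -/(pureB m n) br_pureB // !tmapB_pure br_pureB // gr.
- apply: (eq_tens (lin_comp lc' lfg)
    (lin_comp (tmap_linear (@lin_id _ _) lfg) lc)) => m n.
  rewrite -/(pureB m n) tmapB_pure !bco_pureB // fco gco tlift_tmap //; last lin.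
  rewrite [RHS]linear_tlift; last by apply: tmap_linear.
  apply: eq_tlift => m1 m0; rewrite tlift_tmap //; last lin.
  rewrite [RHS]linear_tlift; last by apply: tmap_linear.
  by apply: eq_tlift => n1 n0; rewrite tmap_pure // tmapB_pure.
Qed.

End TensorProduct.

(** * Contraction with a coinvariant tensor *)

Section RightAugmentation.
Variables (R : realType) (A H : hopfStarAlg R) (pi : hopfStarMap A H).
Local Notation C := R[i].
Local Notation B := (qhs pi).
Variables (M : covBimod pi) (cM : covariant_bimodule M).
Hypothesis aM : augr M =i augl M.

Lemma cls_factor (V : lmodType C) (f : M -> V) (x y : M) : linear f ->
  (forall b m, heps A (val b) = 0 -> f (bl b m) = 0) ->
  cls x = cls y -> f x = f y.
Proof.
move=> lf f0 e; have [_ fE] := rep_factor lf f0.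
by rewrite -(fE x) e fE.
Qed.

(** Since M B^+ = B^+ M, a linear map that kills B^+ M sees the right action, too,
    only through the counit. *)
Lemma linear_br_eps (V : lmodType C) (f : M -> V) b (m : M) : linear f ->
  (forall b m, heps A (val b) = 0 -> f (bl b m) = 0) ->
  f (br m b) = heps A (val b) *: f m.
Proof.
move=> lf f0; rewrite -(lin_scale lf).
apply: (cls_factor lf f0); apply/cls_eq; rewrite -aM.
have -> : br m b - heps A (val b) *: m = br m (b - (heps A (val b))%:A).
  have lb : linear (fun b => br m b) by lin.
  by rewrite (lin_sub lb) (lin_scale lb) (br1 cM).
apply: mem_spanned; exists (b - (heps A (val b))%:A), m; split=> //.
have le : linear (fun b : B => heps A (val b) : C^o) by lin.
by rewrite (lin_sub le) (lin_scale le) /= rmorph1 [_ *: _]mulr1 subrr.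
Qed.

Lemma cls_br b (m : M) : cls (br m b) = heps A (val b) *: cls m.
Proof.
apply: linear_br_eps => [|c n c0]; first exact: cls_lin.
by rewrite (cls_bl cM) c0 scale0r.
Qed.

End RightAugmentation.

Section Contraction.
Variables (R : realType) (A H : hopfStarAlg R) (pi : hopfStarMap A H).
Local Notation C := R[i].
Local Notation B := (qhs pi).
Variables (M N : covBimod pi).
Hypotheses (cM : covariant_bimodule M) (cN : covariant_bimodule N).
Variables (m : cov_tens M N -> cov_unit pi) (mP : cov_morphism m).

Definition contract_l (h : cov_tens N M) (w : M) : M :=
  tlift (fun n m' => bl (m (pureB w n) : B) m') h.
Definition contract_r (h : cov_tens N M) (w : N) : N :=
  tlift (fun n m' => br n (m (pureB m' w) : B)) h.

Lemma lin_pairing (U : lmodType C) (f : U -> cov_tens M N) :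
  linear f -> linear (fun x => m (f x) : B).
Proof. by case: mP => lm _ _ _; exact: (lin_comp lm). Qed.
Ltac lin_atom ::= first [lin_hopf | lin_bimod | lin_pureB | apply: lin_pairing; lin].

Let ml b x : m (bl b x) = b * (m x : B).
Proof. by case: mP. Qed.
Let mr b x : m (br x b) = (m x : B) * b.
Proof. by case: mP. Qed.
Let mco x : qdelta (m x : B) = tmap idfun m (bco x).
Proof. by case: mP => _ _ _ h; exact: h. Qed.
Let m_lin : linear m.
Proof. by case: mP. Qed.

Lemma contract_l_balanced w : balanced (@br _ _ _ _ N) (@bl _ _ _ _ M)
  (fun n m' => bl (m (pureB w n) : B) m').
Proof.
split=> [?|?|n b m']; [lin|lin|].
by rewrite -(br_pureB cN) mr (blA cM).
Qed.

Lemma contract_r_balanced w : balanced (@br _ _ _ _ N) (@bl _ _ _ _ M)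
  (fun n m' => br n (m (pureB m' w) : B)).
Proof.
split=> [?|?|n b m']; [lin|lin|].
by rewrite -(bl_pureB cM) ml (brA cN).
Qed.

Lemma contract_l_pure w n m' :
  contract_l (pureB n m') w = bl (m (pureB w n) : B) m'.
Proof. exact: tlift_pure (contract_l_balanced w). Qed.
Lemma contract_r_pure w n m' :
  contract_r (pureB n m') w = br n (m (pureB m' w) : B).
Proof. exact: tlift_pure (contract_r_balanced w). Qed.

Lemma lin_contract_l (U : lmodType C) (f : U -> cov_tens N M) w :
  linear f -> linear (fun x => contract_l (f x) w).
Proof. exact: (lin_comp (tlift_linear (contract_l_balanced w))). Qed.
Lemma lin_contract_l_arg (U : lmodType C) h (f : U -> M) :
  linear f -> linear (fun x => contract_l h (f x)).
Proof. by move=> lf; rewrite /contract_l; lin. Qed.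
Lemma lin_contract_r (U : lmodType C) (f : U -> cov_tens N M) w :
  linear f -> linear (fun x => contract_r (f x) w).
Proof. exact: (lin_comp (tlift_linear (contract_r_balanced w))). Qed.
Lemma lin_contract_r_arg (U : lmodType C) h (f : U -> N) :
  linear f -> linear (fun x => contract_r h (f x)).
Proof. by move=> lf; rewrite /contract_r; lin. Qed.
Ltac lin_atom ::= first [lin_hopf | lin_bimod | lin_pureB | apply: lin_pairing; lin
  | apply: lin_contract_l; lin | apply: lin_contract_r; lin
  | apply: lin_contract_l_arg; lin | apply: lin_contract_r_arg; lin].

(** Coinvariance of h says that h' and h'' contribute nothing to the coaction of
    m(w (x) h') h''; only the coaction of w remains. *)
Lemma contract_l_colinear h w : bco h = 1 \ox h ->
  bco (contract_l h w) = tmap idfun (contract_l h) (bco w).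
Proof.
move=> hco; pose K w1 w0 (z : A \ox (cov_tens N M)) : A \ox M :=
  tlift (fun a x => (w1 * a) \ox contract_l x w0) z.
have bK w1 w0 : balanced (@rscale C A) (@lscale C (cov_tens N M))
  (fun a x => (w1 * a) \ox contract_l x w0) by lin.
transitivity (tlift (fun w1 w0 => K w1 w0 (bco h)) (bco w)); last first.
  by rewrite hco; apply: eq_tlift => w1 w0; rewrite /K tlift_pure // mulr1.
rewrite {1}/contract_l (linear_tlift _ _ (bco_lin cM)).
transitivity (tlift (fun w1 w0 =>
    tlift (fun n m' => K w1 w0 (bco (pureB n m'))) h) (bco w)); last first.
  apply: eq_tlift => w1 w0.
  apply: (tlift_eta (ra := @br _ _ _ _ N) (la := @bl _ _ _ _ M)
    (V := (A \ox M)%type) (h := fun x : cov_tens N M => K w1 w0 (bco x))).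
  apply: (lin_comp (tlift_linear (bK w1 w0))).
  by have [_ _] := tens_linear cN cM.
rewrite exchange_tlift; apply: eq_tlift => n m'.
rewrite (bco_bl cM) mco tlift_tmap //; last lin.
rewrite (bco_pureB cM cN) linear_tlift; last by apply: tlift_linear; lin.
apply: eq_tlift => w1 w0.
rewrite linear_tlift; last by apply: tlift_linear; lin.
rewrite (bco_pureB cN cM) /K linear_tlift; last exact: tlift_linear.
apply: eq_tlift => n1 n0; rewrite tlift_pure; last lin.
rewrite linear_tlift; last exact: tlift_linear.
by apply: eq_tlift => m1 m0; rewrite tlift_pure // contract_l_pure mulrA.
Qed.

Lemma contract_r_colinear h w : bco h = 1 \ox h ->
  bco (contract_r h w) = tmap idfun (contract_r h) (bco w).
Proof.
move=> hco; pose K w1 w0 (z : A \ox (cov_tens N M)) : A \ox N :=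
  tlift (fun a x => (a * w1) \ox contract_r x w0) z.
have bK w1 w0 : balanced (@rscale C A) (@lscale C (cov_tens N M))
  (fun a x => (a * w1) \ox contract_r x w0) by lin.
transitivity (tlift (fun w1 w0 => K w1 w0 (bco h)) (bco w)); last first.
  by rewrite hco; apply: eq_tlift => w1 w0; rewrite /K tlift_pure // mul1r.
rewrite {1}/contract_r (linear_tlift _ _ (bco_lin cN)).
transitivity (tlift (fun w1 w0 =>
    tlift (fun n m' => K w1 w0 (bco (pureB n m'))) h) (bco w)); last first.
  apply: eq_tlift => w1 w0.
  apply: (tlift_eta (ra := @br _ _ _ _ N) (la := @bl _ _ _ _ M)
    (V := (A \ox N)%type) (h := fun x : cov_tens N M => K w1 w0 (bco x))).
  apply: (lin_comp (tlift_linear (bK w1 w0))).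
  by have [_ _] := tens_linear cN cM.
rewrite exchange_tlift; apply: eq_tlift => n m'.
transitivity (tlift (fun n1 n0 => tlift (fun m1 m0 => tlift (fun w1 w0 =>
  (n1 * m1 * w1) \ox br n0 (m (pureB m0 w0) : B)) (bco w)) (bco m')) (bco n)).
  rewrite (bco_br cN); apply: eq_tlift => n1 n0.
  rewrite mco tlift_tmap //; last lin.
  rewrite (bco_pureB cM cN) linear_tlift; last by apply: tlift_linear; lin.
  apply: eq_tlift => m1 m0; rewrite linear_tlift; last by apply: tlift_linear; lin.
  by apply: eq_tlift => w1 w0; rewrite tlift_pure ?mulrA //; lin.
rewrite [RHS](eq_tlift _ (g := fun w1 w0 => tlift (fun n1 n0 => tlift (fun m1 m0 =>
  (n1 * m1 * w1) \ox br n0 (m (pureB m0 w0) : B)) (bco m')) (bco n))); last first.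
  move=> w1 w0; rewrite (bco_pureB cN cM) /K linear_tlift; last exact: tlift_linear.
  apply: eq_tlift => n1 n0; rewrite linear_tlift; last exact: tlift_linear.
  by apply: eq_tlift => m1 m0; rewrite tlift_pure // contract_r_pure.
rewrite [RHS]exchange_tlift; apply: eq_tlift => n1 n0.
by rewrite exchange_tlift.
Qed.

(** Both sides are g' (x) m(g'' (x) h') h'', as the scalar in the middle may be
    moved across the tensor sign. *)
Lemma contract_exchange g h :
  tlift (fun n m' => pureB n (contract_l h m')) g
  = tlift (fun n m' => pureB (contract_r g n) m') h.
Proof.
transitivity (tlift (fun n m' => tlift (fun n' m'' =>
   pureB n (bl (m (pureB m' n') : B) m'')) h) g).
  by apply: eq_tlift => n m'; rewrite {1}/contract_l linear_tlift //; lin.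
rewrite exchange_tlift; apply: eq_tlift => n' m''.
rewrite {1}/contract_r (linear_tlift (h := fun z => pureB z m'')); last lin.
by apply: eq_tlift => n m'; rewrite pureB_middle.
Qed.

Hypotheses (aM : augr M =i augl M) (aN : augr N =i augl N).
Hypothesis A_flat : faithfully_flat_right (fun (a : A) (b : B) => a * val b).

Lemma cls_contract_l_pure w n m' :
  cls (contract_l (pureB n m') w) = heps A (val (m (pureB w n) : B)) *: cls m'.
Proof. by rewrite contract_l_pure (cls_bl cM). Qed.
Lemma cls_contract_r_pure w n m' :
  cls (contract_r (pureB n m') w) = heps A (val (m (pureB m' w) : B)) *: cls n.
Proof. by rewrite contract_r_pure (cls_br cN aN). Qed.

(** The factor b passes through the tensor sign to the right of w, hence, modulo
    B^+ M, to its left. *)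
Lemma eps_pairing_bl w b n : heps A (val b) = 0 ->
  heps A (val (m (pureB w (bl b n)) : B)) = 0.
Proof.
move=> b0; rewrite -pureB_middle.
have lf : linear (fun w => heps A (val (m (pureB w n) : B)) : C^o) by lin.
rewrite (linear_br_eps cM aM b w lf) ?b0 ?scale0r // => c w' c0.
by rewrite -(bl_pureB cM) ml [val _](rmorphM (val : B -> A)) rmorphM /= c0 mul0r.
Qed.

Lemma cls_contract_l_bl w b x : heps A (val b) = 0 ->
  cls (contract_l (bl b x) w) = 0.
Proof.
move=> b0; have [ll _ _] := tens_linear cN cM.
have lf : linear (fun x => cls (contract_l (bl b x) w)).
  by apply: (lin_comp (@cls_lin _ _ _ _ M)); apply: lin_contract_l; exact: ll.
elim/pureB_ind: x => [|x y hx hy|n m'].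
- exact: lin_zero lf.
- by rewrite (lin_add lf) hx hy addr0.
- by rewrite (bl_pureB cN) cls_contract_l_pure eps_pairing_bl // scale0r.
Qed.

Lemma cls_contract_r_bl w b x : heps A (val b) = 0 ->
  cls (contract_r (bl b x) w) = 0.
Proof.
move=> b0; have [ll _ _] := tens_linear cN cM.
have lf : linear (fun x => cls (contract_r (bl b x) w)).
  by apply: (lin_comp (@cls_lin _ _ _ _ N)); apply: lin_contract_r; exact: ll.
elim/pureB_ind: x => [|x y hx hy|n m'].
- exact: lin_zero lf.
- by rewrite (lin_add lf) hx hy addr0.
- by rewrite (bl_pureB cN) cls_contract_r_pure (cls_bl cN) b0 scale0r scaler0.
Qed.

Section Zigzag.
Variables (h : cov_tens N M) (k : nat) (n_ : 'I_k -> N) (m_ : 'I_k -> M).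
Hypotheses (hco : bco h = 1 \ox h)
  (hcls : cls h = cls (\sum_(i < k) pureB (n_ i) (m_ i) : cov_tens N M)).

(** The class of the contraction depends only on the class of h, so it may be
    computed from any representative of that class. *)
Lemma contract_l_id :
  (forall w, \sum_(i < k) heps A (val (m (pureB w (n_ i)) : B)) *: cls (m_ i)
     = cls w) ->
  forall w, contract_l h w = w.
Proof.
move=> e; apply: (colinear_id cM A_flat) => [w||w].
- exact: contract_l_colinear.
- by lin.
have lf : linear (fun x => cls (contract_l x w)).
  by apply: (lin_comp (@cls_lin _ _ _ _ M)); lin.
rewrite (cls_factor (M := cov_tens N M) lf (@cls_contract_l_bl w) hcls).
rewrite (Defs.linear_sum _ _ lf) -e.
by apply: eq_bigr => i _; rewrite cls_contract_l_pure.
Qed.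

Lemma contract_r_id :
  (forall w, \sum_(i < k) heps A (val (m (pureB (m_ i) w) : B)) *: cls (n_ i)
     = cls w) ->
  forall w, contract_r h w = w.
Proof.
move=> e; apply: (colinear_id cN A_flat) => [w||w].
- exact: contract_r_colinear.
- by lin.
have lf : linear (fun x => cls (contract_r x w)).
  by apply: (lin_comp (@cls_lin _ _ _ _ N)); lin.
rewrite (cls_factor (M := cov_tens N M) lf (@cls_contract_r_bl w) hcls).
rewrite (Defs.linear_sum _ _ lf) -e.
by apply: eq_bigr => i _; rewrite cls_contract_r_pure.
Qed.

End Zigzag.

End Contraction.

(** * Star maps and the reality of coinvariant tensors *)

Section Star.
Variables (R : realType) (A H : hopfStarAlg R) (pi : hopfStarMap A H).
Local Notation C := R[i].
Local Notation B := (qhs pi).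
Local Notation conjm V := (twist (Num.conj : {rmorphism C -> C}) V).

(** Antilinearity is expressed as linearity into the conjugate vector space, so
    that the universal property of the tensor product applies to star maps. *)
Definition star_map (M N : covBimod pi) (s : M -> N) : Prop :=
  [/\ linear (s : M -> conjm N),
      forall b m, s (bl b m) = br (s m) (qstar b),
      forall b m, s (br m b) = bl (qstar b) (s m)
    & forall m, bco (s m) = tmap (@hstar _ A) s (bco m)].

Lemma star_lin (D : hopfStarAlg R) : linear (@hstar _ D : D -> conjm D).
Proof. by move=> c x y; have [h _ _] := hstarP D; exact: h. Qed.

Lemma hstarM (D : hopfStarAlg R) (x y : D) : hstar (x * y) = hstar y * hstar x.
Proof. by have [_ _ h] := hstarP D. Qed.
Lemma hstarK (D : hopfStarAlg R) : involutive (@hstar _ D).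
Proof. by have [_ h _] := hstarP D. Qed.
Lemma hstar1 (D : hopfStarAlg R) : hstar (1 : D) = 1.
Proof. by rewrite -[LHS]mulr1 -{2}[1](hstarK (1 : D)) -hstarM mulr1 hstarK. Qed.

Lemma eps_qstar (b : B) : heps A (val (qstar b)) = (heps A (val b))^*.
Proof. exact: heps_star. Qed.

Section Dagger.
Variables (M M' N N' : covBimod pi) (s : M -> M') (s' : N -> N').
Hypotheses (cM : covariant_bimodule M) (cN : covariant_bimodule N).
Hypotheses (cM' : covariant_bimodule M') (cN' : covariant_bimodule N').
Hypotheses (sP : star_map s) (s'P : star_map s').

(** For s = s' this is the involution (x (x) y)^dag = y^* (x) x^*; two different
    maps are needed because * exchanges the bidegrees (p,q) and (q,p). *)
Definition dag : cov_tens M N -> cov_tens N' M' :=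
  tlift (fun x y => pureB (s' y) (s x)).

Lemma dag_balanced : balanced (@br _ _ _ _ M) (@bl _ _ _ _ N)
  (fun x y => pureB (s' y) (s x) : conjm (cov_tens N' M')).
Proof.
have [ls sl sr _] := sP; have [ls' sl' sr' _] := s'P.
split=> [n c x y|m c x y|m b n].
- by rewrite ls; exact: (pure_linearr _ _ _ c^*).
- by rewrite ls'; exact: (pure_linearl _ _ _ c^*).
- by rewrite sr sl' pureB_middle.
Qed.

Lemma dag_lin : linear (dag : cov_tens M N -> conjm (cov_tens N' M')).
Proof. exact: tlift_linear dag_balanced. Qed.

Lemma dag_pureB m n : dag (pureB m n) = pureB (s' n) (s m).
Proof. exact: (tlift_pure _ _ dag_balanced). Qed.

Let K : A \ox cov_tens M N -> A \ox cov_tens N' M' :=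
  tlift (fun a x => hstar a \ox dag x).
Let K_bal : balanced (@rscale C A) (@lscale C (cov_tens M N))
  (fun a x => hstar a \ox dag x : conjm (A \ox cov_tens N' M')%type).
Proof.
apply: bilinear_balanced => [x c a b|a c x y].
  by rewrite star_lin; exact: (pure_linearl _ _ _ c^*).
by rewrite dag_lin; exact: (pure_linearr _ _ _ c^*).
Qed.
Let K_lin : linear (K : A \ox cov_tens M N -> conjm (A \ox cov_tens N' M')%type).
Proof. exact: tlift_linear K_bal. Qed.

Lemma bco_dag x : bco (dag x) = K (bco x).
Proof.
have [_ _ lc] := tens_linear cM cN; have [_ _ lc'] := tens_linear cN' cM'.
elim/pureB_ind: x => [|x y hx hy|m n].
- rewrite (lin_zero lc) (lin_zero K_lin) (lin_zero dag_lin); exact: lin_zero lc'.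
- rewrite (lin_add lc) (lin_add K_lin) -hx -hy (lin_add dag_lin).
  exact: lin_add lc' _ _.
have [_ _ _ sco] := sP; have [_ _ _ sco'] := s'P.
have star_tlift (V : lmodType C) (P P' : lmodType C) (f : P -> P')
    (F : A -> P' -> V) (z : A \ox P) :
  balanced (@rscale C A) (@lscale C P') F ->
  tlift F (tmap (@hstar _ A) f z) = tlift (fun a w => F (hstar a) (f w)) z.
  move=> bF; rewrite /tmap linear_tlift; last exact: tlift_linear.
  by apply: eq_tlift => a w; rewrite tlift_pure.
rewrite dag_pureB !bco_pureB // sco sco' star_tlift; last lin.
rewrite [RHS](linear_tlift (W := conjm _) _ _ K_lin).
rewrite [RHS](eq_tlift _ (g := fun m1 m0 => tlift (fun n1 n0 =>
    hstar (m1 * n1) \ox pureB (s' n0) (s m0)) (bco n))); last first.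
  move=> m1 m0; rewrite (linear_tlift (W := conjm _) _ _ K_lin).
  apply: eq_tlift => n1 n0; rewrite -dag_pureB; exact: (tlift_pure _ _ K_bal).
rewrite exchange_tlift; apply: eq_tlift => n1 n0.
rewrite star_tlift; last lin.
by apply: eq_tlift => m1 m0; rewrite hstarM.
Qed.

(** The involution of A reverses products, which compensates the exchange of the
    two tensor factors. *)
Lemma dag_coinvariant x : bco x = 1 \ox x -> bco (dag x) = 1 \ox dag x.
Proof.
by move=> e; rewrite bco_dag e -[in RHS](hstar1 A); exact: (tlift_pure _ _ K_bal).
Qed.

End Dagger.
End Star.

Section SelfAdjoint.
Variables (R : realType) (A H : hopfStarAlg R) (pi : hopfStarMap A H).
Local Notation C := R[i].
Local Notation B := (qhs pi).
Local Notation conjm V := (twist (Num.conj : {rmorphism C -> C}) V).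
Variables (M N : covBimod pi).
Hypotheses (cM : covariant_bimodule M) (cN : covariant_bimodule N).
Hypotheses (aM : augr M =i augl M) (aN : augr N =i augl N).
Hypothesis A_flat : faithfully_flat_right (fun (a : A) (b : B) => a * val b).
Variables (m : cov_tens M N -> cov_unit pi) (mP : cov_morphism m).
Variables (s : M -> N) (s' : N -> M) (sP : star_map s) (s'P : star_map s').
Hypothesis sK : cancel s s'.
Variables (g : cov_tens N M) (k : nat) (v : 'I_k -> M).
Hypotheses (gco : bco g = 1 \ox g)
  (gcls : cls g = cls (\sum_(i < k) pureB (s (v i)) (v i) : cov_tens N M)).
Hypotheses
  (ml : forall w, \sum_(i < k) heps A (val (m (pureB w (s (v i))) : B)) *: cls (v i)
    = cls w)
  (mr : forall w, \sum_(i < k) heps A (val (m (pureB (v i) w) : B)) *: cls (s (v i))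
    = cls w).

(** The adjoint of g has the class of the sum of the (s v_i (x) v_i)^dag, which
    are again s v_i (x) v_i; so the fibre computation for g applies to it. *)
Lemma contract_dag_id w : contract_l m (dag s' s g) w = w.
Proof.
have ld := dag_lin s'P sP.
apply: (colinear_id cM A_flat) => {w} [w||w].
- by apply: contract_l_colinear => //; apply: dag_coinvariant.
- exact: lin_contract_l_arg.
have lf : linear (fun x => cls (contract_l m (dag s' s x) w) : conjm (Phi M)).
  have lh : linear (fun z : cov_tens N M => cls (contract_l m z w)).
    by apply: (lin_comp (@cls_lin _ _ _ _ M)); exact: lin_contract_l.
  by move=> c x y; rewrite ld; exact: (lh c^*).
have f0 b x : heps A (val b) = 0 -> cls (contract_l m (dag s' s (bl b x)) w) = 0.
  move=> b0; have [ll _ _] := tens_linear cN cM.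
  elim/pureB_ind: x => [|x y hx hy|n m'].
  - by rewrite (lin_zero (ll b)); exact: (lin_zero lf).
  - by rewrite (lin_add (ll b)) (lin_add lf) hx hy; exact: addr0.
  - rewrite bl_pureB // dag_pureB // cls_contract_l_pure //.
    have [_ sl _ _] := s'P.
    by rewrite sl (cls_br cM aM) eps_qstar b0 conjC0 scale0r scaler0.
have -> := cls_factor (M := cov_tens N M) lf f0 gcls.
rewrite (Defs.linear_sum _ _ lf) -ml.
by apply: eq_bigr => i _; rewrite dag_pureB // cls_contract_l_pure // sK.
Qed.

(** Contracting g with its adjoint on either side yields the other factor. *)
Lemma dag_id : dag s' s g = g.
Proof.
have e1 := contract_r_id cM cN mP aN A_flat gco gcls mr.
have := contract_exchange m g (dag s' s g).
rewrite (eq_tlift _ (g := fun n m' => pureB n m')); last first.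
  by move=> n m'; rewrite contract_dag_id.
rewrite [RHS](eq_tlift _ (g := fun n m' => pureB n m')); last first.
  by move=> n m'; rewrite e1.
by move=> e; rewrite [LHS]tens_pure [RHS]tens_pure; exact: esym.
Qed.

End SelfAdjoint.

(** * Covariant bimodules of differential forms *)

Lemma tmul_tmap (K : comNzRingType) (A D : algType K) (V W : lmodType K)
    (f : V -> D) (g : W -> D) (x : A \ox V) (y : A \ox W) :
  linear f -> linear g ->
  tmul (tmap idfun f x) (tmap idfun g y)
  = tlift (fun a v => tlift (fun b w => (a * b) \ox (f v * g w)) y) x.
Proof.
move=> lf lg; rewrite {2}/tmap (linear_tlift _ _ (tmul_linearl _)).
apply: eq_tlift => a v; rewrite /tmap (linear_tlift _ _ (tmul_linearr _)).
by apply: eq_tlift => b w; rewrite tmul_pure.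
Qed.

Lemma tmap_pure_id (K : comNzRingType) (M N N' : lmodType K) (g : N -> N') m n :
  linear g -> tmap (fun m : M => m) g (m \ox n) = m \ox g n.
Proof. by move=> lg; rewrite tmap_pure. Qed.

Section SubBimodule.
Variables (R : realType) (A H : hopfStarAlg R) (pi : hopfStarMap A H).
Local Notation C := R[i].
Local Notation B := (qhs pi).
Local Notation conjm V := (twist (Num.conj : {rmorphism C -> C}) V).
Variable Om : covCalc pi.

Lemma elts_val_lin (U : submodClosed Om) : linear (val : elts U -> Om).
Proof. by move=> c x y; rewrite linearP. Qed.

Lemma form0_lin : linear (form0 Om).
Proof. exact: linearP. Qed.
Lemma fco_lin : linear (fco Om).
Proof. exact: linearP. Qed.

Section Subcomodule.
Variables (U : submodClosed Om)
  (Ul : forall b x, x \in U -> form0 Om b * x \in U)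
  (Ur : forall b x, x \in U -> x * form0 Om b \in U).
Hypothesis Uco : subcomodule (fco Om) U.
Local Notation S := (sub_bimod (fco Om) Ul Ur).

Lemma bco_val (w : S) : tmap idfun (val : elts U -> Om) (bco w) = fco Om (val w).
Proof. exact: corestrP (Uco (valP w)). Qed.

Lemma tmap_val_inj (V : lmodType C) :
  injective (tmap idfun val : V \ox elts U -> V \ox Om).
Proof. by apply: tmap_inj; [exact: elts_val_lin | exact: val_inj]. Qed.

(** Each identity holds in the algebra of forms, and A (x) U and A (x) A (x) U
    embed in the tensor products with that algebra. *)
Lemma sub_covariant : covariant_bimodule S.
Proof.
have lv := @elts_val_lin U; have lf := form0_lin.
have lco : linear (@bco _ _ _ _ S).
  move=> c x y; apply: tmap_val_inj.
  rewrite (tmap_linear (@lin_id _ _) lv) !bco_val; exact: fco_lin.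
split.
- split=> [b c x y|w c x y|w|a b w]; apply: val_inj => /=.
  + by rewrite mulrDr scalerAr.
  + by rewrite lf mulrDl scalerAl.
  + by rewrite rmorph1 mul1r.
  + by rewrite rmorphM mulrA.
- split=> [b c x y|w c x y|w|a b w]; apply: val_inj => /=.
  + by rewrite mulrDl scalerAl.
  + by rewrite lf mulrDr scalerAr.
  + by rewrite rmorph1 mulr1.
  + by rewrite rmorphM mulrA.
- by move=> b c w; apply: val_inj => /=; rewrite mulrA.
- have [lfc assoc counit] := fco_coaction Om; split=> // w.
  + apply: (tmap_inj (tmap_linear (@lin_id _ _) lv) (@tmap_val_inj _)).
    have lJ : linear (tmap idfun (tmap idfun val) :
      A \ox (A \ox elts U)%type -> A \ox (A \ox Om)%type).
      by apply: tmap_linear => //; exact: tmap_linear.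
    transitivity (tlift (fun a u => a \ox fco Om (val u)) (bco w)).
      rewrite (linear_tlift _ _ lJ); apply: eq_tlift => a u.
      rewrite -(bco_val u) (linear_tlift (h := pure _ _ a)); last exact: pure_linearr.
      rewrite (linear_tlift _ _ lJ); apply: eq_tlift => a' u'.
      by rewrite !tmap_pure_id //; exact: tmap_linear.
    transitivity (tlift (fun a x => a \ox fco Om x) (fco Om (val w))).
      by rewrite -(bco_val w) tlift_tmap //; apply: tmap_balanced.
    transitivity (tlift (fun a x =>
        tlift (fun a1 a2 => a1 \ox (a2 \ox x)) (hdelta A a)) (fco Om (val w))).
      rewrite -assoc; apply: eq_tlift => a x.
      by rewrite (tlift_eta (h := pure _ _ a)) //; exact: pure_linearr.
    rewrite -(bco_val w) tlift_tmap //; last lin.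
    rewrite (linear_tlift _ _ lJ); apply: eq_tlift => a u.
    rewrite (linear_tlift _ _ lJ); apply: eq_tlift => a1 a2.
    by rewrite !tmap_pure_id //; exact: tmap_linear.
  + apply: val_inj; rewrite -[RHS]counit -bco_val tlift_tmap //; last lin.
    exact: linear_tlift lv.
- move=> b c w; apply: tmap_val_inj; rewrite bco_val.
  rewrite [val _](_ : _ = form0 Om b * (val w * form0 Om c)) // !fcoM !fco_form0.
  rewrite -bco_val.
  have lmap (V W : lmodType C) (g : V -> W) : linear g ->
    linear (tmap idfun g : A \ox V -> A \ox W) by exact: tmap_linear.
  rewrite [tmul (tmap _ _ (bco w)) _]tmul_tmap //.
  set Y := tlift _ (bco w).
  rewrite [X in tmul X Y]/tmap (linear_tlift _ _ (tmul_linearl Y)) {}/Y.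
  rewrite (linear_tlift _ _ (lmap _ _ _ lv)).
  apply: eq_tlift => b1 b2; rewrite (linear_tlift _ _ (lmap _ _ _ lv)).
  rewrite (linear_tlift _ _ (tmul_linearr _)).
  apply: eq_tlift => w1 w0; rewrite (linear_tlift _ _ (lmap _ _ _ lv)).
  rewrite (linear_tlift _ _ (tmul_linearr _)).
  apply: eq_tlift => c1 c2; rewrite tmul_pure tmap_pure_id //=.
  by rewrite mulrA.
Qed.

End Subcomodule.

Variables (U U' : submodClosed Om)
  (Ul : forall b x, x \in U -> form0 Om b * x \in U)
  (Ur : forall b x, x \in U -> x * form0 Om b \in U)
  (Ul' : forall b x, x \in U' -> form0 Om b * x \in U')
  (Ur' : forall b x, x \in U' -> x * form0 Om b \in U').
Hypotheses (Uco : subcomodule (fco Om) U) (Uco' : subcomodule (fco Om) U').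
Local Notation S := (sub_bimod (fco Om) Ul Ur).
Local Notation S' := (sub_bimod (fco Om) Ul' Ur').

Lemma inclusion_morphism (f : S -> S') :
  (forall w, val (f w) = val w) -> cov_morphism f.
Proof.
move=> fE.
have lf : linear f.
  by move=> c x y; apply: val_inj; rewrite (@elts_val_lin U') !fE (@elts_val_lin U).
split=> //.
- by move=> b w; apply: val_inj; rewrite /= !fE.
- by move=> b w; apply: val_inj; rewrite /= !fE.
- move=> w; apply: (@tmap_val_inj U'); rewrite bco_val // fE -(bco_val Uco).
  rewrite (tmap_comp _ (@lin_id _ _) lf (@lin_id _ _) (@elts_val_lin U')).
  by apply: eq_tmap => // u; rewrite fE.
Qed.

(** No sign appears in (b w)^* = w^* b^* because b has degree 0. *)
Lemma star_star_map (f : S -> S') (k : nat) :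
  (forall w : S, val w \in fdeg Om k) ->
  (forall w : S, val (f w) = fstar (val w)) -> star_map f.
Proof.
move=> Uk fE; have lv' := @elts_val_lin U'.
have b0 b : form0 Om b \in fdeg Om 0 by apply/fdeg0; exists b.
split.
- move=> c x y; apply: val_inj; rewrite fE (@elts_val_lin U) fstarD -!fE.
  by rewrite -(@elts_val_lin U').
- move=> b w; apply: val_inj; rewrite /= !fE /=.
  by rewrite (fstarM (b0 b) (Uk w)) mul0n expr0 mul1r fstar_form0.
- move=> b w; apply: val_inj; rewrite /= !fE /=.
  by rewrite (fstarM (Uk w) (b0 b)) muln0 expr0 mul1r fstar_form0.
- move=> w; apply: (@tmap_val_inj U'); rewrite bco_val // fE fco_star.
  rewrite -(bco_val Uco).
  pose K : A \ox Om -> A \ox Om := tmap (@hstar _ A) (@fstar _ _ _ Om).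
  have bK : balanced (@rscale C A) (@lscale C Om)
      (fun a x => hstar a \ox fstar x : conjm (A \ox Om)%type).
    apply: bilinear_balanced => [x c a b|a c x y].
      by rewrite star_lin; exact: (pure_linearl _ _ _ c^*).
    by rewrite fstarD; exact: (pure_linearr _ _ _ c^*).
  have lK : linear (K : A \ox Om -> conjm (A \ox Om)%type) by exact: tlift_linear.
  rewrite -/K [in LHS]/tmap (linear_tlift (W := conjm _) _ _ lK).
  have lJ : linear (tmap idfun val : A \ox elts U' -> A \ox Om) by exact: tmap_linear.
  rewrite [X in _ = tmap _ _ X]/tmap (linear_tlift _ _ lJ).
  apply: eq_tlift => a u; rewrite tmap_pure_id // fE.
  exact: (tlift_pure _ _ bK).
Qed.

End SubBimodule.

(** * Fibrewise duality of the (p,q)-forms and the (q,p)-forms *)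

Section Fibre.
Variables (R : realType) (A H : hopfStarAlg R) (pi : hopfStarMap A H).
Local Notation C := R[i].
Local Notation B := (qhs pi).
Local Notation conjm V := (twist (Num.conj : {rmorphism C -> C}) V).

Lemma cls_bl_eq0 (M : covBimod pi) b (m : M) :
  heps A (val b) = 0 -> cls (bl b m) = 0.
Proof.
move=> b0; rewrite -(lin_zero (@cls_lin _ _ _ _ M)); apply/cls_eq.
by rewrite subr0; apply: mem_spanned; exists b, m.
Qed.

Lemma eps_unit_lin : linear (fun b : cov_unit pi => heps A (val (b : B)) : C^o).
Proof. by move=> c x y; exact: (lin_eps (@val_lin _ _ _ pi)). Qed.

Lemma eps_unit_bl b (c : cov_unit pi) : heps A (val b) = 0 ->
  heps A (val (bl b c : B)) = 0.
Proof. by move=> b0; rewrite [val _](rmorphM (val : B -> A)) rmorphM /= b0 mul0r. Qed.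

Lemma Phi_unit_cls (b : cov_unit pi) : Phi_unit (cls b) = heps A (val (b : B)).
Proof. by have [_ h] := rep_factor eps_unit_lin eps_unit_bl; exact: h. Qed.

Lemma Phi_map_cls (M N : covBimod pi) (f : M -> N) (m : M) : cov_morphism f ->
  Phi_map f (cls m) = cls (f m).
Proof.
move=> [lf fl _ _].
have [|_ h] := @rep_factor _ _ _ _ M _ _ (lin_comp (@cls_lin _ _ _ _ N) lf);
  last exact: h.
by move=> b x b0; rewrite fl cls_bl_eq0.
Qed.

Section PhiTensor.
Variables (M N : covBimod pi).
Hypothesis cM : covariant_bimodule M.
Hypotheses (aM : augr M =i augl M).

Let clsB_bl_l b (m : M) (n : N) : heps A (val b) = 0 ->
  cls (pureB (bl b m) n) = 0.
Proof. by move=> b0; rewrite -(bl_pureB cM) cls_bl_eq0. Qed.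

Let linl (n : N) : linear (fun m : M => cls (pureB m n)).
Proof. by apply: (lin_comp (@cls_lin _ _ _ _ (cov_tens M N))); exact: lin_pureB_l. Qed.
Let linr (m : M) : linear (fun n : N => cls (pureB m n)).
Proof. by apply: (lin_comp (@cls_lin _ _ _ _ (cov_tens M N))); exact: lin_pureB_r. Qed.

Let clsB_bl_r b (m : M) (n : N) : heps A (val b) = 0 ->
  cls (pureB m (bl b n)) = 0.
Proof.
move=> b0; rewrite -pureB_middle (linear_br_eps cM aM b m (linl n)) ?b0 ?scale0r //.
by move=> c m' c0; exact: clsB_bl_l.
Qed.

(** Well defined in the first factor as B^+ acts on the left; in the second one
    because m (x) b n = m b (x) n and M B^+ = B^+ M. *)
Lemma Phi_tens_cls (m : M) (n : N) : Phi_tens (cls m \ox cls n) = cls (pureB m n).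
Proof.
have L (n' : N) := rep_factor (linl n') (fun b m => @clsB_bl_l b m n').
have L' (m' : M) := rep_factor (linr m') (fun b n => @clsB_bl_r b m' n).
rewrite [LHS]tlift_pure.
  by rewrite (L _).2 (L' _).2.
by apply: bilinear_balanced => [v|u]; [exact: (L _).1 | exact: (L' _).1].
Qed.

Lemma Phi_tens_lin : linear (@Phi_tens _ _ _ _ M N).
Proof.
have L (n' : N) := rep_factor (linl n') (fun b m => @clsB_bl_l b m n').
have L' (m' : M) := rep_factor (linr m') (fun b n => @clsB_bl_r b m' n).
apply: tlift_linear.
by apply: bilinear_balanced => [v|u]; [exact: (L _).1 | exact: (L' _).1].
Qed.

End PhiTensor.

(** The involution maps B^+ M into N B^+ = B^+ N. *)
Lemma star_fibre (M N : covBimod pi) (s : M -> N) :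
  covariant_bimodule N -> augr N =i augl N -> star_map s ->
  linear (fun u : Phi M => cls (s (rep u)) : conjm (Phi N)) /\
  forall m, cls (s (rep (cls m))) = cls (s m).
Proof.
move=> cN aN [ls sl _ _].
have lf : linear (fun m => cls (s m) : conjm (Phi N)).
  by move=> c x y; rewrite ls; exact: (@cls_lin _ _ _ _ N c^*).
apply: (rep_factor lf) => b m b0.
by rewrite sl (cls_br cN aN) eps_qstar b0 conjC0 scale0r.
Qed.

End Fibre.

Section Duality.
Variables (R : realType) (A H : hopfStarAlg R) (pi : hopfStarMap A H).
Local Notation C := R[i].
Local Notation B := (qhs pi).
Local Notation conjm V := (twist (Num.conj : {rmorphism C -> C}) V).
Hypothesis A_flat : faithfully_flat_right (fun (a : A) (b : B) => a * val b).
Variables (Om : covCalc pi) (cs : complexStr Om) (cs_cov : covariant_complex cs).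

Lemma pq_covariant p q : covariant_bimodule (pqforms cs p q).
Proof. exact: sub_covariant. Qed.

Lemma pq_star p q : star_map (@pqstar _ _ _ _ Om cs p q).
Proof.
apply: (@star_star_map _ _ _ _ _ _ _ _ _ _ _ _ _ _ (p + q)) => // w.
exact: bideg_sub (valP w).
Qed.

Lemma pqstarK p q (w : pqforms cs p q) : pqstar (pqstar w) = w.
Proof. by apply: val_inj; exact: fstarK. Qed.

Variables (p q : nat).
Local Notation M := (pqforms cs p q).
Local Notation N := (pqforms cs q p).
Hypotheses (aM : augr M =i augl M) (aN : augr N =i augl N).
Variable ip : Phi M -> Phi M -> C.
Hypothesis ipP : inner_product ip.
Variables (m : cov_tens M N -> cov_unit pi) (cv : cov_unit pi -> cov_tens N M).
Hypotheses (mP : assoc_pairing ip m) (cvP : assoc_coev ip cv).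
Local Notation g := (cv (1 : B)).

Let cM := pq_covariant p q.
Let cN := pq_covariant q p.

(** The defining property of the pairing, read on elements. *)
Lemma pairing_fibre (w : M) (n : N) :
  heps A (val (m (pureB w n) : B)) = ip (cls w) (cls (pqstar n)).
Proof.
have [mm /(_ (cls w) (cls n))] := mP.
rewrite (Phi_tens_cls cM aM) Phi_map_cls // Phi_unit_cls => ->.
congr (ip _ _); have [_ h] := star_fibre cM aM (pq_star q p); exact: h.
Qed.

Lemma coev_coinvariant : bco g = 1 \ox g.
Proof.
have [[lc _ _ cc] _] := cvP; rewrite cc.
by rewrite [bco _](@qdelta1 _ _ _ pi) tmap_pure_id.
Qed.

(** On the fibres g is the sum of the v_i^* (x) v_i over an orthonormal basis, so
    the contractions are w |-> sum_i <w, v_i> v_i and its conjugate. *)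
Lemma pq_duality :
  [/\ forall w, contract_l m g w = w, forall w, contract_r m g w = w
    & dag (@pqstar _ _ _ _ Om cs q p) (@pqstar _ _ _ _ Om cs p q) g = g].
Proof.
have [mm _] := mP; have [cvm [k [v [[von vgen] vE]]]] := cvP.
have [ipl ipc _] := ipP.
have [lst stE] := star_fibre cN aN (pq_star p q).
pose e i : M := rep (v i).
have eK i : cls (e i) = v i := repK _.
have expand u : \sum_(i < k) ip u (v i) *: v i = u.
  have [c ->] := vgen u; apply: eq_bigr => i _; congr (_ *: _).
  have lip : linear (fun u => ip u (v i) : C^o) by move=> d x y; exact: ipl.
  rewrite (Defs.linear_sum _ _ lip) (bigD1 i) //= (lin_scale lip) von eqxx.
  rewrite [_ *: _]mulr1 big1 ?addr0 // => j ji.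
  by rewrite (lin_scale lip) von (negbTE ji) scaler0.
have gcls : cls g = cls (\sum_(i < k) pureB (pqstar (e i)) (e i) : cov_tens N M).
  rewrite -(@Phi_map_cls _ _ _ _ (cov_unit pi) (cov_tens N M) cv (1 : B) cvm) vE.
  rewrite (Defs.linear_sum _ _ (Phi_tens_lin cN aN)).
  rewrite (Defs.linear_sum _ _ (@cls_lin _ _ _ _ (cov_tens N M))).
  by apply: eq_bigr => i _; rewrite -(Phi_tens_cls cN aN) eK.
have ml w : \sum_(i < k) heps A (val (m (pureB w (pqstar (e i))) : B)) *: cls (e i)
    = cls w.
  rewrite -[RHS]expand; apply: eq_bigr => i _.
  by rewrite pairing_fibre pqstarK eK.
have mr w : \sum_(i < k) heps A (val (m (pureB (e i) w) : B)) *: cls (pqstar (e i))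
    = cls w.
  rewrite -[w in RHS]pqstarK -stE -[X in rep X]expand.
  rewrite [RHS](Defs.linear_sum (V := conjm (Phi N)) _ _ lst).
  apply: eq_bigr => i _; rewrite [RHS](lin_scale lst) pairing_fibre eK ipc //.
have gco := coev_coinvariant.
split.
- exact: (contract_l_id cM cN mm aM A_flat gco gcls ml).
- exact: (contract_r_id cM cN mm aN A_flat gco gcls mr).
- exact: (dag_id cM cN aM aN A_flat mm (pq_star p q) (pq_star q p) (@pqstarK p q)
    gco gcls ml mr).
Qed.

End Duality.

(** * One-forms and the metric *)

Section Retracts.
Variables (R : realType) (A H : hopfStarAlg R) (pi : hopfStarMap A H).
Local Notation C := R[i].
Local Notation B := (qhs pi).
Variables (P X : covBimod pi) (i : P -> X) (r : X -> P).
Hypotheses (iP : cov_morphism i) (rP : cov_morphism r) (iK : cancel i r).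

(** B^+ P and P B^+ are transported to X, compared there, and projected back. *)
Lemma retract_aug : augr X =i augl X -> augr P =i augl P.
Proof.
have [li il ir _] := iP; have [lr rl rr _] := rP.
move=> aX x; apply/idP/idP => hx; rewrite -(iK x).
- suff : i x \in augl X.
    apply: (spanned_sub lr) => _ [b [y [b0 ->]]]; rewrite rl.
    by apply: mem_spanned; exists b, (r y).
  rewrite -aX; apply: (spanned_sub li) hx => _ [b [y [b0 ->]]]; rewrite ir.
  by apply: mem_spanned; exists b, (i y).
- suff : i x \in augr X.
    apply: (spanned_sub lr) => _ [b [y [b0 ->]]]; rewrite rr.
    by apply: mem_spanned; exists b, (r y).
  rewrite aX; apply: (spanned_sub li) hx => _ [b [y [b0 ->]]]; rewrite il.
  by apply: mem_spanned; exists b, (i y).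
Qed.

End Retracts.

Section Projection.
Variables (R : realType) (A H : hopfStarAlg R) (pi : hopfStarMap A H).
Local Notation C := R[i].
Local Notation B := (qhs pi).
Variables (P Q X : covBimod pi) (i : P -> X) (j : Q -> X) (p : X -> P) (q : X -> Q).
Hypothesis cX : covariant_bimodule X.
Hypotheses (iP : cov_morphism i) (jP : cov_morphism j).
Hypotheses (pq : forall x, x = i (p x) + j (q x))
  (pE : forall u v, p (i u + j v) = u).

(** A projection of a direct sum of bimodules commutes with whatever the two
    inclusions commute with. *)
Lemma projection_morphism : cov_morphism p.
Proof.
have [li il ir ico] := iP; have [lj jl jr jco] := jP.
have [ll lr lc] := covariant_linear cX.
have lp : linear p.
  move=> c x y; rewrite {1}(pq x) {1}(pq y) scalerDr addrACA.
  by rewrite -(lin_scale li) -(lin_scale lj) -(lin_add li) -(lin_add lj) pE.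
have pi_ u : p (i u) = u by rewrite -[RHS](pE u 0) (lin_zero lj) addr0.
have pj v : p (j v) = 0 by rewrite -[RHS](pE 0 v) (lin_zero li) add0r.
split=> //.
- by move=> b x; rewrite {1}(pq x) (lin_add (ll b)) -il -jl pE.
- by move=> b x; rewrite {1}(pq x) (lin_add (lr b)) -ir -jr pE.
- move=> x; rewrite [in RHS](pq x) (lin_add lc) ico jco.
  rewrite (lin_add (tmap_linear (@lin_id _ _) lp)).
  rewrite !tmap_comp // (eq_tmap (f' := idfun) (g' := idfun)) // tmap_id.
  rewrite [X in _ + X](_ : _ = 0) ?addr0 //.
  rewrite /tmap /tlift big1 // => z _; rewrite pj.
  exact: lin_zero (pure_linearr _ _ _).
Qed.

End Projection.

Lemma dag_tmapB (R : realType) (A H : hopfStarAlg R) (pi : hopfStarMap A H)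
    (M N M' N' X Y X' Y' : covBimod pi)
    (i : M -> X) (j : N -> Y) (i' : M' -> X') (j' : N' -> Y')
    (s : M -> M') (s' : N -> N') (t : X -> X') (t' : Y -> Y') x :
  cov_morphism i' -> cov_morphism j' -> star_map t -> star_map t' ->
  (forall m, t (i m) = i' (s m)) -> (forall n, t' (j n) = j' (s' n)) ->
  dag t t' (tmapB i j x) = tmapB j' i' (dag s s' x).
Proof.
move=> iP jP tP tP' ti tj.
rewrite /tmapB (linear_tlift (W := twist _ (cov_tens Y' X')) _ _ (dag_lin tP tP')).
rewrite {2}/dag (linear_tlift _ _ (tlift_linear (tmapB_balanced jP iP))).
apply: eq_tlift => m n; rewrite [LHS](dag_pureB tP tP') ti tj.
by rewrite [RHS](tmapB_pure jP iP).
Qed.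

Section OneForms.
Variables (R : realType) (A H : hopfStarAlg R) (pi : hopfStarMap A H).
Local Notation C := R[i].
Local Notation B := (qhs pi).
Variables (Om : covCalc pi) (cs : complexStr Om) (cs_cov : covariant_complex cs).
Local Notation X := (forms Om 1).
Local Notation M := (pqforms cs 1 0).
Local Notation N := (pqforms cs 0 1).

Definition incl10 : M -> X := @pqincl _ _ _ _ Om cs 1 0.
Definition incl01 : N -> X := @pqincl _ _ _ _ Om cs 0 1.

Lemma forms_covariant : covariant_bimodule X.
Proof. exact: fdeg_covariant. Qed.

Lemma incl10_morphism : cov_morphism incl10.
Proof. by apply: inclusion_morphism => //; exact: fdeg_subcomodule. Qed.
Lemma incl01_morphism : cov_morphism incl01.
Proof. by apply: inclusion_morphism => //; exact: fdeg_subcomodule. Qed.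

Lemma one_form_split (w : X) : exists u v, w = incl10 u + incl01 v.
Proof.
have /(bideg_total cs)[f [fP]] := valP w.
rewrite big_ord_recl big_ord1 /= => e.
exists (exist _ (f 1 0) (fP 1 0)), (exist _ (f 0 1) (fP 0 1)).
by apply: val_inj; exact: etrans e (addrC _ _).
Qed.

Lemma one_form_uniq (u u' : M) (v v' : N) :
  val u + val v = val u' + val v' -> u = u' /\ v = v'.
Proof.
move=> e; have [_ indep] := bideg_direct cs.
have memB a b x y : x \in bideg cs a b -> y \in bideg cs a b -> x - y \in bideg cs a b.
  by move=> xU yU; rewrite -scaleN1r rpredD ?rpredZ.
pose f (a : nat * nat) : Om := if a == (1, 0)%N then val u - val u'
  else if a == (0, 1)%N then val v - val v' else 0.
have fP a : f a \in bideg cs a.1 a.2.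
  rewrite /f; case: eqP => [->|_]; first by apply: memB; exact: valP.
  case: eqP => [->|_]; last exact: rpred0.
  by apply: memB; exact: valP.
have := indep [:: (1, 0); (0, 1)]%N f isT fP.
rewrite big_cons big_seq1 {1}/f /= {1}/f /= addrACA -opprD e subrr => /(_ erefl) f0.
have /= := f0 (1, 0)%N isT; have /= := f0 (0, 1)%N isT.
by rewrite /f /= => /eqP; rewrite subr_eq0 => /eqP/val_inj-> /eqP;
  rewrite subr_eq0 => /eqP/val_inj->.
Qed.

Lemma pr_incl u v :
  pr10 cs (incl10 u + incl01 v) = u /\ pr01 cs (incl10 u + incl01 v) = v.
Proof.
split.
- have [v' /=] : exists v' : N, val (incl10 u + incl01 v)
      = val (pr10 cs (incl10 u + incl01 v)) + val v'.
    by apply: (@xgetPex _ 0 (fun u' : M => exists v' : N,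
      val (incl10 u + incl01 v) = val u' + val v')); exists u, v.
  by move/one_form_uniq => [].
- have [u' /=] : exists u' : M, val (incl10 u + incl01 v)
      = val u' + val (pr01 cs (incl10 u + incl01 v)).
    by apply: (@xgetPex _ 0 (fun v' : N => exists u' : M,
      val (incl10 u + incl01 v) = val u' + val v')); exists v, u.
  by move/one_form_uniq => [].
Qed.

Lemma pr_sum (w : X) : w = incl10 (pr10 cs w) + incl01 (pr01 cs w).
Proof.
have [u [v ->]] := one_form_split w.
by have [-> ->] := pr_incl u v.
Qed.

Lemma pr10_morphism : cov_morphism (@pr10 _ _ _ _ Om cs).
Proof.
apply: (projection_morphism forms_covariant
  incl10_morphism incl01_morphism pr_sum) => u v.
by case: (pr_incl u v).
Qed.

Lemma pr01_morphism : cov_morphism (@pr01 _ _ _ _ Om cs).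
Proof.
apply: (projection_morphism forms_covariant
  incl01_morphism incl10_morphism) => [w|v u].
- exact: etrans (pr_sum w) (addrC _ _).
- by rewrite addrC; case: (pr_incl u v).
Qed.

Lemma pr10_incl10 u : pr10 cs (incl10 u) = u.
Proof.
by have [li _ _ _] := incl01_morphism; case: (pr_incl u 0); rewrite (lin_zero li) addr0.
Qed.
Lemma pr01_incl01 v : pr01 cs (incl01 v) = v.
Proof.
by have [li _ _ _] := incl10_morphism; case: (pr_incl 0 v); rewrite (lin_zero li) add0r.
Qed.
Lemma pr10_incl01 v : pr10 cs (incl01 v) = 0.
Proof.
by have [li _ _ _] := incl10_morphism; case: (pr_incl 0 v); rewrite (lin_zero li) add0r.
Qed.
Lemma pr01_incl10 u : pr01 cs (incl10 u) = 0.
Proof.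
by have [li _ _ _] := incl01_morphism; case: (pr_incl u 0); rewrite (lin_zero li) addr0.
Qed.

Lemma forms_star_map : star_map (@forms_star _ _ _ _ Om 1).
Proof.
apply: (@star_star_map _ _ _ _ _ _ _ _ _ _ _ _ _ _ 1) => //;
  try exact: fdeg_subcomodule.
by move=> w; exact: valP.
Qed.

Lemma forms_star_incl10 (u : M) : forms_star (incl10 u) = incl01 (pqstar u).
Proof. exact: val_inj. Qed.
Lemma forms_star_incl01 (v : N) : forms_star (incl01 v) = incl10 (pqstar v).
Proof. exact: val_inj. Qed.

End OneForms.

Theorem theorem3p6 (R : realType) (A H : hopfStarAlg R)
  (pi : hopfStarMap A H)
  (pi_surj : forall h : H, exists a : A, pi a = h)
  (A_flat : faithfully_flat_right (fun (a : A) (b : qhs pi) => a * val b))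
  (H_cqg : cqg_algebra H)
  (Om : covCalc pi) (cs : complexStr Om) (cs_cov : covariant_complex cs)
  (Om1 : mod0 (forms Om 1))
  (ip10 : Phi (pqforms cs 1 0) -> Phi (pqforms cs 1 0) -> R[i])
  (ip01 : Phi (pqforms cs 0 1) -> Phi (pqforms cs 0 1) -> R[i])
  (ip10P : invariant_inner_product ip10)
  (ip01P : invariant_inner_product ip01)
  (m10 : cov_tens (pqforms cs 1 0) (pqforms cs 0 1) -> cov_unit pi)
  (cv10 : cov_unit pi -> cov_tens (pqforms cs 0 1) (pqforms cs 1 0))
  (m01 : cov_tens (pqforms cs 0 1) (pqforms cs 1 0) -> cov_unit pi)
  (cv01 : cov_unit pi -> cov_tens (pqforms cs 1 0) (pqforms cs 0 1))
  (m10P : assoc_pairing ip10 m10) (cv10P : assoc_coev ip10 cv10)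
  (m01P : assoc_pairing ip01 m01) (cv01P : assoc_coev ip01 cv01)
  (lam : R) (lam0 : lam != 0) :
  let met := form_metric lam m10 m01 in
  let g := form_coev lam cv10 cv01 (1 : qhs pi) in
  [/\ is_metric g met,
      covariant_metric g met,
      dagger (@forms_star _ _ _ _ Om 1) g = g
    & forall w h : forms Om 1,
        (val w \in bideg cs 1 0 /\ val h \in bideg cs 1 0) \/
        (val w \in bideg cs 0 1 /\ val h \in bideg cs 0 1) ->
        met (pureB w h) = 0].
Proof.
move=> met g.
have [cX _ aX] := Om1.
pose M := pqforms cs 1 0; pose N := pqforms cs 0 1.
have cM : covariant_bimodule M := pq_covariant cs_cov 1 0.
have cN : covariant_bimodule N := pq_covariant cs_cov 0 1.
have i10 := incl10_morphism cs_cov; have i01 := incl01_morphism cs_cov.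
have r10 := pr10_morphism cs_cov; have r01 := pr01_morphism cs_cov.
have aM : augr M =i augl M by exact: retract_aug i10 r10 (pr10_incl10 cs_cov) aX.
have aN : augr N =i augl N by exact: retract_aug i01 r01 (pr01_incl01 cs_cov) aX.
have [zl10 zr10 dag10] := pq_duality A_flat cs_cov aM aN ip10P.1 m10P cv10P.
have [zl01 zr01 dag01] := pq_duality A_flat cs_cov aN aM ip01P.1 m01P cv01P.
have [mm10 _] := m10P; have [mm01 _] := m01P.
have [mc10 _] := cv10P; have [mc01 _] := cv01P.
have metE : met = fun x => m10 (tmapB (pr10 cs) (pr01 cs) x)
    - (lam^-1)%:C%C *: m01 (tmapB (pr01 cs) (pr10 cs) x).
  have [l10 _ _ _] := mm10; have [l01 _ _ _] := mm01.
  apply: funext => x; rewrite /tmapB (linear_tlift _ _ l10) (linear_tlift _ _ l01).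
  by rewrite /met /form_metric /tlift scaler_sumr -sumrB.
have met_mor : cov_morphism met.
  rewrite metE; apply: (cov_morphism_subZ _ (unit_linear pi)).
  - exact: cov_morphism_comp (tmapB_morphism cX cX cM cN r10 r01) mm10.
  - exact: cov_morphism_comp (tmapB_morphism cX cX cN cM r01 r10) mm01.
have coev_mor : cov_morphism (form_coev lam cv10 cv01).
  apply: (cov_morphism_subZ _ (tens_linear cX cX)).
  - exact: cov_morphism_comp mc10 (tmapB_morphism cN cM cX cX i01 i10).
  - exact: cov_morphism_comp mc01 (tmapB_morphism cM cN cX cX i10 i01).
have metP w h : met (pureB w h) = m10 (pureB (pr10 cs w) (pr01 cs h))
    - (lam^-1)%:C%C *: m01 (pureB (pr01 cs w) (pr10 cs h)).
  by rewrite metE (tmapB_pure r10 r01) (tmapB_pure r01 r10).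
have pureB0 (P Q : covBimod pi) (x : P) : pureB x (0 : Q) = 0.
  exact: lin_zero (pure_linearr _ _ _).
have pure0B (P Q : covBimod pi) (x : Q) : pureB (0 : P) x = 0.
  exact: lin_zero (pure_linearl _ _ _).
have [l10 _ _ _] := mm10; have [l01 _ _ _] := mm01.
have lamK : lam%:C%C * (lam^-1)%:C%C = 1 :> R[i].
  by rewrite -rmorphM mulfV.
have gE (V : lmodType R[i]) (f : forms Om 1 -> forms Om 1 -> V) :
    balanced (@br _ _ _ _ (forms Om 1)) (@bl _ _ _ _ (forms Om 1)) f ->
    tlift f g = tlift (fun n m => f (incl01 n) (incl10 m)) (cv10 (1 : qhs pi))
      - lam%:C%C *: tlift (fun m n => f (incl10 m) (incl01 n)) (cv01 (1 : qhs pi)).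
  move=> bf; rewrite /g /form_coev (lin_sub (tlift_linear bf)).
  rewrite (lin_scale (tlift_linear bf)).
  by rewrite !tlift_tmapB.
have [lmet blmet brmet comet] := met_mor.
have l010 := lin_zero l10; have l001 := lin_zero l01.
have met_l10 w n : met (pureB w (incl01 n)) = m10 (pureB (pr10 cs w) n).
  by rewrite metP pr10_incl01 // pr01_incl01 // pureB0 l001 scaler0 subr0.
have met_l01 w n : met (pureB w (incl10 n))
    = - (lam^-1)%:C%C *: m01 (pureB (pr01 cs w) n).
  by rewrite metP pr10_incl10 // pr01_incl10 // pureB0 l010 add0r scaleNr.
have met_r10 w n : met (pureB (incl10 n) w) = m10 (pureB n (pr01 cs w)).
  by rewrite metP pr10_incl10 // pr01_incl10 // pure0B l001 scaler0 subr0.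
have met_r01 w n : met (pureB (incl01 n) w)
    = - (lam^-1)%:C%C *: m01 (pureB n (pr10 cs w)).
  by rewrite metP pr10_incl01 // pr01_incl01 // pure0B l010 add0r scaleNr.
have [li10 il10 ir10 _] := i10; have [li01 il01 ir01 _] := i01.
(* the weight -1/lam of the metric undoes the weight -lam of g *)
have cancel_lam (x : forms Om 1) : - (lam%:C%C *: (- (lam^-1)%:C%C *: x)) = x.
  by rewrite scaleNr scalerN opprK scalerA lamK scale1r.
split.
- split=> // w.
  + rewrite (gE _ _ (contract_l_balanced cX cX met_mor w)) [RHS](pr_sum cs w).
    congr (_ + _).
      rewrite -[in RHS](zl10 (pr10 cs w)) /contract_l (linear_tlift _ _ li10).
      by apply: eq_tlift => n m; rewrite met_l10 il10.
    rewrite -[RHS]cancel_lam; congr (- (_ *: _)).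
    rewrite -[in RHS](zl01 (pr01 cs w)) /contract_l.
    rewrite (linear_tlift _ _ li01) -tlift_paramZ.
    apply: eq_tlift => n m; rewrite met_l01 il01.
    by rewrite (lin_scale (lin_bl_arg cX (incl01 m) (@lin_id _ _))).
  + rewrite (gE _ _ (contract_r_balanced cX cX met_mor w)) [RHS](pr_sum cs w) addrC.
    congr (_ + _).
      rewrite -[RHS]cancel_lam; congr (- (_ *: _)).
      rewrite -[in RHS](zr01 (pr10 cs w)) /contract_r.
      rewrite (linear_tlift _ _ li10) -tlift_paramZ.
      apply: eq_tlift => n m; rewrite met_r01 ir10.
      by rewrite (lin_scale (lin_br_arg cX (incl10 n) (@lin_id _ _))).
    rewrite -[in RHS](zr10 (pr01 cs w)) /contract_r (linear_tlift _ _ li01).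
    by apply: eq_tlift => n m; rewrite met_r10 ir01.
- split=> // b.
  have [_ gl _ gco] := coev_mor.
  have glE (c : cov_unit pi) : bl (c : qhs pi) g = form_coev lam cv10 cv01 c.
    by rewrite -gl; congr form_coev; exact: mulr1.
  by rewrite glE gco; apply: eq_tmap.
- have st1 := forms_star_map Om.
  have s10 := @forms_star_incl10 _ _ _ _ _ cs.
  have s01 := @forms_star_incl01 _ _ _ _ _ cs.
  rewrite [LHS](_ : _ = dag (@forms_star _ _ _ _ Om 1) (@forms_star _ _ _ _ Om 1) g) //.
  rewrite /g /form_coev.
  rewrite (lin_sub (dag_lin st1 st1)) (lin_scale (dag_lin st1 st1)).
  rewrite (dag_tmapB _ i10 i01 st1 st1 s01 s10) (dag_tmapB _ i01 i10 st1 st1 s10 s01).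
  rewrite dag10 dag01; congr (_ - _).
  (* the adjoint conjugates the coefficient lam, which is real *)
  exact: (congr1 (fun c : R[i] => c *: _) (conjc_real lam)).
- move=> w h wh; rewrite metP.
  have pr01_0 (x : forms Om 1) : val x \in bideg cs 1 0 -> pr01 cs x = 0.
    move=> x10; rewrite -(pr01_incl10 cs_cov (exist _ (val x) x10)); congr pr01.
    exact: val_inj.
  have pr10_0 (x : forms Om 1) : val x \in bideg cs 0 1 -> pr10 cs x = 0.
    move=> x01; rewrite -(pr10_incl01 cs_cov (exist _ (val x) x01)); congr pr10.
    exact: val_inj.
  case: wh => [[/pr01_0-> /pr01_0->]|[/pr10_0-> /pr10_0->]];
    by rewrite pureB0 pure0B l010 l001 scaler0 subr0.
Qed.
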